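(* Let $L_+$, $L_-$ and $L_0$ be three oriented starred link diagrams in $S^2$ that differ from each other at exactly one crossing $v$, where $v$ is positive in $L_+$, negative in $L_-$, and smoothed in the oriented way in $L_0$. Assume that the four regions incident to $v$ are mutually distinct regions in $L_+$ and $L_-$. Then the skein relation $$\nabla_{L_+}(W)-\nabla_{L_-}(W)=(W-W^{-1})\nabla_{L_0}(W)$$ holds at $v$ if (i) none of the regions incident to $v$ is starred, or (ii) two adjacent regions incident to $v$ are starred, or (iii) both the up and the down regions incident to $v$ are starred.
   Context: Link diagrams in $S^2$ are generic immersions of finitely many oriented circles with over/under information at the finitely many transverse double points (crossings). The regions of a diagram are the connected components of the complement of its underlying 4-valent graph (the universe). A starred diagram is a diagram together with stars placed either on some of its regions or on some of its crossings so that the number of unstarred regions equals the number of unstarred crossings; a connected link diagram in $S^2$ with $n$ crossings has $n+2$ regions, hence exactly two starred regions. Draw a neighbourhood of the crossing $v$ with both strands directed from left to right: the right region is the out-corner (between the two outgoing edges), the left region is the in-corner (between the two incoming edges), and the up and down regions are the two side corners. Two of these four regions are adjacent at $v$ if they share an edge at $v$, i.e. one of them is left or right and the other is up or down. In $L_0$ the oriented smoothing merges the left and right regions into a single region $F$; the stars of $L_+$, $L_-$ and $L_0$ correspond ($F$ is starred in $L_0$ exactly when the left or right region is starred in $L_\pm$; all other regions keep their stars). Labels. At a positive crossing the out-corner has label $W$, the in-corner $-W^{-1}$, and both side corners $1$. At a negative crossing the out-corner has label $W^{-1}$, the in-corner $-W$, and both side corners $1$. A state of a starred diagram assigns to every unstarred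 region one marker, placed at a corner of that region at an unstarred crossing, so that every unstarred crossing receives exactly one marker (if a region occupies several corners at one crossing, different corners give different states). The weight of a state is the product of the labels of the marked corners. The mock Alexander polynomial $\nabla_L(W)$ is the sum of the weights of all states of $L$. *)

(* Defs.v *)
(* Starred link diagrams on the unit sphere of R^3, given as smooth generic
   immersions of circles, and their mock Alexander polynomial. *)
From HB Require Import structures.
From mathcomp Require Import all_boot all_order all_algebra.
From mathcomp Require Import all_classical all_reals all_analysis.

Set Implicit Arguments.
Unset Strict Implicit.
Unset Printing Implicit Defensive.

Import Order.TTheory GRing.Theory Num.Theory.
Import numFieldNormedType.Exports.

Local Open Scope classical_set_scope.
Local Open Scope card_scope.
Local Open Scope ring_scope.

(* The four corners at a crossing, seen with both strands running from left to
   right: OutCorner is on the right, InCorner on the left. *)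
Inductive corner := OutCorner | InCorner | UpCorner | DownCorner.

Definition corner_code (c : corner) : bool * bool :=
  match c with
  | OutCorner => (true, true) | InCorner => (false, false)
  | UpCorner => (true, false) | DownCorner => (false, true)
  end.

Definition corner_decode (b : bool * bool) : corner :=
  match b with
  | (true, true) => OutCorner | (false, false) => InCorner
  | (true, false) => UpCorner | (false, true) => DownCorner
  end.

Lemma corner_codeK : cancel corner_code corner_decode.
Proof. by case. Qed.

HB.instance Definition _ := Finite.copy corner (can_type corner_codeK).

Definition side_corner (c : corner) : bool :=
  match c with UpCorner | DownCorner => true | _ => false end.

Definition adjacent_corners (c c' : corner) : Prop :=
  side_corner c <> side_corner c'.

Section Space.
Context {R : realType}.
Notation point := 'rV[R]_3.

Definition dot (x y : point) : R := \sum_(i < 3) x 0 i * y 0 i.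

Definition sphere : set point := [set x | dot x x = 1].

Definition normalize (x : point) : point := (Num.sqrt (dot x x))^-1 *: x.

(* For x on the sphere and y, z tangent at x, this is positive exactly when
   (y, z) turns counterclockwise as seen from outside the sphere. *)
Definition triple (x y z : point) : R :=
  \det (\matrix_(i < 3, j < 3) [:: x; y; z]`_i 0 j).

Section Curves.
Variables (n : nat) (f : 'I_n -> R -> point).

(* Each circle is R/Z, so its points are parametrized by [0, 1). *)
Definition fiber (p : point) : set ('I_n * R) :=
  [set q | 0 <= q.2 < 1 /\ f q.1 q.2 = p].

Definition tangent (q : 'I_n * R) : point := derive1 (f q.1) q.2.

Definition curves_crossings : set point :=
  [set p | exists q q', [/\ fiber p q, fiber p q' & q <> q']].

(* The finiteness of the double points, automatic by compactness, is recorded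
   for convenience. *)
Definition generic_immersion : Prop :=
  [/\ forall i t, f i (t + 1) = f i t,
      forall i t, sphere (f i t),
      forall i k t, derivable (derive1n k (f i)) t 1,
      forall i t, derive1 (f i) t != 0 &
      [/\ forall p q1 q2 q3, fiber p q1 -> fiber p q2 -> fiber p q3 ->
            [\/ q1 = q2, q1 = q3 | q2 = q3],
          forall p q q', fiber p q -> fiber p q' -> q <> q' ->
            triple p (tangent q) (tangent q') != 0 &
          finite_set curves_crossings]].

End Curves.

Record diagram := Diagram {
  ncircles : nat;
  strand : 'I_ncircles -> R -> point;
  passes_over : set ('I_ncircles * R);
  diagram_immersion : generic_immersion strand;
  diagram_over_under : forall p, curves_crossings strand p ->
    exists q q', [/\ fiber strand p q, fiber strand p q',
                     passes_over q & ~ passes_over q']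
}.

Section Diagram.
Variable D : diagram.

Definition universe : set point := [set p | fiber (@strand D) p !=set0].

Definition crossings : set point := curves_crossings (@strand D).

Definition heading (q : 'I_(ncircles D) * R) : point :=
  normalize (tangent (@strand D) q).

(* The universe as an oriented curve, independently of parametrizations. *)
Definition oriented_universe (p u : point) : Prop :=
  exists2 q, fiber (@strand D) p q & heading q = u.

Definition over_heading (p : point) : point :=
  xget 0 (heading @` (fiber (@strand D) p `&` @passes_over D)).

Definition under_heading (p : point) : point :=
  xget 0 (heading @` (fiber (@strand D) p `\` @passes_over D)).

Definition positive_crossing (p : point) : Prop :=
  crossings p /\ 0 < triple p (over_heading p) (under_heading p).

Definition negative_crossing (p : point) : Prop :=
  crossings p /\ triple p (over_heading p) (under_heading p) < 0.

(* With both strands drawn from left to right, the overcrossing strand of a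
   positive crossing runs from upper left to lower right. *)
Definition rising_heading (p : point) : point :=
  if `[< positive_crossing p >] then under_heading p else over_heading p.

Definition falling_heading (p : point) : point :=
  if `[< positive_crossing p >] then over_heading p else under_heading p.

Definition corner_heading (p : point) (c : corner) : point :=
  match c with
  | OutCorner => rising_heading p + falling_heading p
  | InCorner => - (rising_heading p + falling_heading p)
  | UpCorner => rising_heading p - falling_heading p
  | DownCorner => falling_heading p - rising_heading p
  end.

Definition corner_point (p : point) (c : corner) (t : R) : point :=
  normalize (p + t *: corner_heading p c).

Definition regions : set (set point) :=
  [set connected_component (sphere `\` universe) x
    | x in sphere `\` universe].

(* The region containing corner_point p c t for all sufficiently small t > 0;
   distinct corners of a crossing may lie in the same region. *)
Definition corner_region (p : point) (c : corner) : set point :=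
  [set x | \forall t \near 0^'+,
    connected_component (sphere `\` universe) (corner_point p c t) x].

End Diagram.

Record starred_diagram := StarredDiagram {
  starred_diagram_of :> diagram;
  starred_regions : set (set point);
  starred_crossings : set point;
  starred_regionsP : starred_regions `<=` regions starred_diagram_of;
  starred_crossingsP : starred_crossings `<=` crossings starred_diagram_of;
  (* stars are placed either on regions or on crossings *)
  starred_kind : starred_regions = set0 \/ starred_crossings = set0;
  starred_balance :
    (regions starred_diagram_of `\` starred_regions) #=
    (crossings starred_diagram_of `\` starred_crossings)
}.

Definition W : {fraction {poly int}} := tofrac 'X.

Section State.
Variable L : starred_diagram.

Definition unstarred_regions : set (set point) :=
  regions L `\` starred_regions L.

Definition unstarred_crossings : set point :=
  crossings L `\` starred_crossings L.

Definition label (m : point * corner) : {fraction {poly int}} :=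
  let pos := `[< positive_crossing L m.1 >] in
  match m.2 with
  | OutCorner => if pos then W else W^-1
  | InCorner => if pos then - W^-1 else - W
  | UpCorner | DownCorner => 1
  end.

(* A state is identified with its set of markers. *)
Definition states : set (set (point * corner)) :=
  [set M | [/\ forall m, M m -> unstarred_crossings m.1 /\
                 unstarred_regions (corner_region L m.1 m.2),
               forall r, unstarred_regions r ->
                 exists! m, M m /\ corner_region L m.1 m.2 = r &
               forall p, unstarred_crossings p -> exists! m, M m /\ m.1 = p]].

Definition weight (M : set (point * corner)) : {fraction {poly int}} :=
  \big[*%R/1]_(m \in M) label m.

Definition mock_alexander : {fraction {poly int}} :=
  \sum_(M \in states) weight M.

End State.

Section Skein.
Variables (Lp Lm L0 : starred_diagram) (v : point).

Definition quadrant (c : corner) : set (R * R) :=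
  match c with
  | OutCorner => [set z | `|z.2| < z.1]
  | InCorner => [set z | `|z.2| < - z.1]
  | UpCorner => [set z | `|z.1| < z.2]
  | DownCorner => [set z | `|z.1| < - z.2]
  end.

Definition box : set (R * R) := [set z | `|z.1| <= 1 /\ `|z.2| <= 1].

Definition open_embedding (h : R * R -> point) : Prop :=
  [/\ continuous h, injective h, range h `<=` sphere &
      forall U, open U -> exists2 V, open V & h @` U = V `&` sphere].

(* A drawing of a neighbourhood of v in which both strands run from left to
   right along the diagonals. *)
Definition crossing_chart (D : diagram) (h : R * R -> point) : Prop :=
  [/\ open_embedding h, h (0, 0) = v,
      h @^-1` universe D = [set z | `|z.2| = `|z.1|],
      crossings D `&` range h = [set v] &
      forall c, \forall t \near 0^'+, (h @` quadrant c) (corner_point D v c t)].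

Definition crossing_change : Prop :=
  [/\ positive_crossing Lp v /\ negative_crossing Lm v,
      forall p u, oriented_universe Lp p u <-> oriented_universe Lm p u,
      forall p, crossings Lp p -> p <> v -> over_heading Lp p = over_heading Lm p,
      starred_regions Lm = starred_regions Lp &
      starred_crossings Lm = starred_crossings Lp].

(* In the chart, the diagonals are replaced inside the box by the two arcs
   y = g x and y = - g x.  Nothing changes outside the box, so both arcs
   inherit the orientation from left to right. *)
Definition oriented_smoothing (h : R * R -> point) (g : R -> R) : Prop :=
  [/\ continuous g, forall x, 0 < g x, forall x, 1 <= `|x| -> g x = `|x| &
   [/\ crossing_chart Lp h,
       h @^-1` universe L0 = [set z | `|z.2| = g z.1],
       crossings L0 `&` range h = set0,
       forall p u, ~ (h @` box) p ->
         (oriented_universe Lp p u <-> oriented_universe L0 p u) &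
       forall p, crossings Lp p -> p <> v ->
         over_heading Lp p = over_heading L0 p]].

(* Regions of Lp and L0 correspond when they meet outside the box: the in- and
   out-regions at v both correspond to the region between the two arcs, and
   the other regions correspond bijectively. *)
Definition smoothing_stars (h : R * R -> point) : Prop :=
  starred_regions L0 =
    [set F | regions L0 F /\ exists2 r, starred_regions Lp r &
             (r `&` F) `\` (h @` box) !=set0] /\
  starred_crossings L0 = starred_crossings Lp `\ v.

Definition skein_triple : Prop :=
  crossing_change /\
  exists h g, oriented_smoothing h g /\ smoothing_stars h.

End Skein.

End Space.

Arguments diagram : clear implicits.
Arguments starred_diagram : clear implicits.

(* Main.v *)
(* The universe determines the crossings, the regions and the corners, so L+ and
   L- have the same states, and their weights differ only by the label of the
   marker at v.  Side markers contribute nothing to the difference; out- and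
   in-markers contribute (W - W^-1) times the weight of the other markers.
   Forgetting a marker placed at v in the left or right region is a bijection
   onto the states of L0: these two regions merge into F, and when F is unstarred
   its marker lies in one of them, which forces the marker at v into the other.  Counting unstarred regions and crossings on both sides excludes
   that v itself, or both the left and the right region, are starred.

   For the regions, a function that is constant on the components of one
   complement and agrees outside the box is made locally constant on the other
   complement by giving it, on each quadrant of the box, its value at a point of
   that quadrant outside the box; this needs components of the complement to be
   open, which follows from connectedness of spherical caps. *)
Require Import Defs.
From mathcomp Require Import all_boot all_order all_algebra finmap.
From mathcomp Require Import all_classical all_reals all_analysis.
From mathcomp Require Import ring lra.
Import Order.TTheory GRing.Theory Num.Theory.
Import numFieldNormedType.Exports.
Local Open Scope classical_set_scope.
Local Open Scope card_scope.
Local Open Scope ring_scope.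

(** * Components of open subsets of the sphere *)

Lemma connected_locally_constant {T : topologicalType} {U : Type} (A : set T)
    (f : T -> U) :
  connected A -> (forall x, A x -> \forall y \near x, A y -> f y = f x) ->
  forall x y, A x -> A y -> f x = f y.
Proof.
move=> cA lf x y Ax Ay.
suff AE : A `&` [set z | f z = f x] = A by rewrite -AE in Ay; case: Ay.
apply: cA; first by exists x.
- exists (interior [set z | A z -> f z = f x]); first exact: open_interior.
  apply/seteqP; split=> z [Az] /= zx; split=> //; last first.
    by have /nbhs_singleton := zx; apply.
  by rewrite -zx; exact: lf.
- exists (~` interior [set z | A z -> f z <> f x]).
    by apply: open_closedC; exact: open_interior.
  apply/seteqP; split=> z [Az] /= zx; split=> //; last first.
    apply: contrapT => fzx; apply: zx.
    by apply: filterS (lf z Az) => w /= fw Aw; rewrite (fw Aw).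
  by move=> /nbhs_singleton /(_ Az).
Qed.

Lemma connected_image {T U : topologicalType} (f : T -> U) (A : set T) :
  continuous f -> connected A -> connected (f @` A).
Proof.
move=> cf cA; apply: connected_continuous_connected => //.
exact: continuous_subspaceT.
Qed.

Lemma connected_component_eq {T : topologicalType} (A C : set T) (x y : T) :
  connected C -> C `<=` A -> C x -> C y ->
  connected_component A x = connected_component A y.
Proof.
move=> cC CA Cx Cy; apply: same_connected_component.
exact: (connected_component_max Cx CA cC).
Qed.

Lemma connected_componentP {T : topologicalType} (A : set T) (x y : T) :
  connected_component A x y ->
  [/\ A x, A y & connected_component A x = connected_component A y].
Proof.
move=> xy; split; last exact: same_connected_component.
- apply: contrapT => Ax; move: xy; rewrite connected_component_out//.
- exact: connected_component_sub xy.
Qed.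

Section Sphere.
Context {R : realType}.
Implicit Types x y z : 'rV[R]_3.

Lemma dotE x y : dot x y = x 0 0 * y 0 0 + x 0 1 * y 0 1 + x 0 2%:R * y 0 2%:R.
Proof.
rewrite /dot !big_ord_recr big_ord0 /= add0r.
by congr (x 0 _ * y 0 _ + x 0 _ * y 0 _ + x 0 _ * y 0 _); apply: val_inj.
Qed.

Lemma dotC x y : dot x y = dot y x.
Proof. by rewrite !dotE; ring. Qed.

Lemma dotDr x y z : dot x (y + z) = dot x y + dot x z.
Proof. by rewrite !dotE !mxE; ring. Qed.

Lemma dotZr a x y : dot x (a *: y) = a * dot x y.
Proof. by rewrite !dotE !mxE; ring. Qed.

Lemma dotDl x y z : dot (y + z) x = dot y x + dot z x.
Proof. by rewrite !dotE !mxE; ring. Qed.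

Lemma dotZl a x y : dot (a *: y) x = a * dot y x.
Proof. by rewrite !dotE !mxE; ring. Qed.

Lemma dot_ge0 x : 0 <= dot x x.
Proof. by rewrite /dot sumr_ge0// => i _; rewrite -expr2 sqr_ge0. Qed.

Lemma dot_eq0 x : (dot x x == 0) = (x == 0).
Proof.
apply/eqP/eqP => [|->]; last by rewrite -(scale0r 0) dotZl mul0r.
move=> /eqP; rewrite psumr_eq0 => [/allP x0|i _]; last by rewrite -expr2 sqr_ge0.
apply/rowP => i; rewrite mxE; apply/eqP.
have := x0 i; rewrite mem_index_enum => /(_ isT).
by rewrite -expr2 sqrf_eq0.
Qed.

Lemma dot_gt0 x : x != 0 -> 0 < dot x x.
Proof. by move=> x0; rewrite lt_def dot_ge0 dot_eq0 x0. Qed.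

Lemma continuous_coord {T : topologicalType} (f : T -> 'rV[R]_3) (t : T) i :
  {for t, continuous f} -> {for t, continuous (fun s => f s 0 i)}.
Proof.
move=> cf; apply: (@continuous_comp _ _ _ f (fun M : 'rV[R]_3 => M 0 i)) => //.
exact: coord_continuous.
Qed.

Lemma continuous_dot {T : topologicalType} (f g : T -> 'rV[R]_3) (t : T) :
  {for t, continuous f} -> {for t, continuous g} ->
  {for t, continuous (fun s => dot (f s) (g s))}.
Proof.
move=> cf cg.
have E : (fun s => dot (f s) (g s)) = (fun s =>
    f s 0 0 * g s 0 0 + f s 0 1 * g s 0 1 + f s 0 2%:R * g s 0 2%:R).
  by apply/funext => s; rewrite dotE.
by rewrite E; do 2?[apply: continuousD]; apply: continuousM; exact: continuous_coord.
Qed.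

Lemma continuous_normalize {T : topologicalType} (f : T -> 'rV[R]_3) (t : T) :
  {for t, continuous f} -> f t != 0 ->
  {for t, continuous (fun s => normalize (f s))}.
Proof.
move=> cf ft0; rewrite /normalize; apply: continuousZ => //.
apply: continuousV; first by rewrite sqrtr_eq0 -ltNge dot_gt0.
apply: (@continuous_comp _ _ _ (fun s => dot (f s) (f s)) Num.sqrt).
  exact: continuous_dot.
exact: sqrt_continuous.
Qed.

Lemma normalize_sphere x : x != 0 -> sphere (normalize x).
Proof.
move=> x0; have x1 := dot_gt0 _ x0.
rewrite /sphere /= /normalize dotZl dotZr mulrA -expr2 exprVn sqr_sqrtr ?ltW//.
by rewrite mulVf// gt_eqF.
Qed.

Lemma normalize_id x : sphere x -> normalize x = x.
Proof. by move=> x1; rewrite /normalize x1 sqrtr1 invr1 scale1r. Qed.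

Lemma dot_sub_sphere x y : sphere x -> sphere y ->
  dot (x - y) (x - y) = 2 - 2 * dot x y.
Proof.
rewrite /sphere /= => x1 y1.
by rewrite -scaleN1r dotDr !dotDl !dotZr !dotZl x1 y1 (dotC y x); ring.
Qed.

Lemma dot_sphere_le1 x y : sphere x -> sphere y -> dot x y <= 1.
Proof.
by move=> x1 y1; have := dot_ge0 (x - y); rewrite dot_sub_sphere//; lra.
Qed.

Definition cap (x : 'rV[R]_3) (c : R) : set 'rV[R]_3 :=
  [set y | sphere y /\ c < dot x y].

Lemma cap_connected x c : sphere x -> 0 <= c -> c < 1 -> connected (cap x c).
Proof.
move=> x1 c0 c1.
pose p y (t : R) := x + t *: (y - x).
have pd y t : dot x (p y t) = 1 - t + t * dot x y.
  by rewrite /p dotDr dotZr -[- x]scaleN1r dotDr dotZr x1; ring.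
have pc y t : cap x c y -> t \in `[0, 1] -> c < dot x (p y t).
  rewrite pd => -[y1 yc]; rewrite in_itv/= => /andP[t0 t1].
  rewrite (_ : _ + _ = c + ((1 - t) * (1 - c) + t * (dot x y - c))); last ring.
  rewrite ltrDl; have [->|tn0] := eqVneq t 0; first by lra.
  have tp : 0 < t by rewrite lt_def tn0.
  by rewrite ltr_wpDl ?mulr_gt0 ?mulr_ge0//; lra.
have p0 y t : cap x c y -> t \in `[0, 1] -> p y t != 0.
  move=> yc t01; apply/eqP => p0; have := pc _ _ yc t01.
  by rewrite p0 -(scale0r 0) dotZr mul0r; lra.
have -> : cap x c = \bigcup_(y in cap x c) ((fun t => normalize (p y t)) @` `[0, 1]).
  apply/seteqP; split => [y yc|z [y yc [t t01 <-]]].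
    exists y => //; exists 1; first by rewrite /= in_itv/= ler01 lexx.
    by rewrite /p scale1r addrC subrK normalize_id//; case: yc.
  have pn0 := p0 _ _ yc t01; split; first exact: normalize_sphere.
  rewrite /normalize dotZr.
  have ppos := dot_gt0 _ pn0.
  have ple : dot (p y t) (p y t) <= 1.
    have d1 : dot x y <= 1 by apply: dot_sphere_le1 => //; case: yc.
    have -> : dot (p y t) (p y t) = 1 - t * (1 - t) * (2 - 2 * dot x y).
      have : dot y y = 1 by case: yc.
      have : dot x x = 1 by [].
      rewrite /p -(scaleN1r x) => h1 h2; do !rewrite ?dotDr ?dotDl ?dotZr ?dotZl.
      rewrite h1 h2 (dotC y x). ring.
    move: t01; rewrite /= in_itv/= => /andP[t0 t1].
    by rewrite gerBl mulr_ge0// ?mulr_ge0//; lra.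
  have := pc _ _ yc t01 => /lt_le_trans; apply.
  rewrite ler_peMl//; first by have := pc _ _ yc t01; lra.
  by rewrite invf_ge1 ?sqrtr_gt0// -sqrtr1 ler_wsqrtr.
apply: bigcup_connected.
  exists x => y yc; exists 0; first by rewrite /= in_itv/= ler01 lexx.
  by rewrite /p scale0r addr0 normalize_id.
move=> y yc; apply: connected_continuous_connected.
  exact: segment_connected.
apply: continuous_in_subspaceT => t; rewrite inE => t01.
apply: continuous_normalize; last exact: p0.
apply: continuousD; first exact: cst_continuous.
by apply: continuousZ; [exact: cvg_id|exact: cst_continuous].
Qed.

Lemma sphere_component_open (U : set 'rV[R]_3) x :
  closed U -> (sphere `\` U) x -> \forall y \near x, (sphere `\` U) y ->
    connected_component (sphere `\` U) y = connected_component (sphere `\` U) x.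
Proof.
move=> cU [x1 Ux].
have : nbhs x (~` U) by apply: open_nbhs_nbhs; split => //; exact: closed_openC.
move=> /nbhs_ballP[e /= e0 eU].
pose d := Num.min 1 (e ^+ 2 / 2).
have d0 : 0 < d by rewrite lt_min ltr01 divr_gt0// exprn_gt0.
have d1 : d <= 1 by rewrite ge_min lexx.
have capU : cap x (1 - d) `<=` sphere `\` U.
  move=> y [y1 yd]; split => //; apply: eU; split => // i j; rewrite (ord1 i).
  rewrite /ball /= -ltr_sqr ?nnegrE ?(ltW e0)// real_normK ?num_real//.
  have : (x 0 j - y 0 j) ^+ 2 <= dot (x - y) (x - y).
    rewrite /dot (bigD1 j)//= !mxE -expr2 lerDl sumr_ge0// => k _.
    by rewrite -expr2 sqr_ge0.
  have : d <= e ^+ 2 / 2 by rewrite ge_min lexx orbT.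
  rewrite dot_sub_sphere//; lra.
have : \forall y \near x, 1 - d < dot x y.
  have : {for x, continuous (dot x)}.
    by apply: continuous_dot; [exact: cst_continuous|exact: cvg_id].
  by move/cvgr_gt; apply; rewrite (x1 : dot x x = 1) gtrBl.
apply: filterS => y yd [y1 Uy].
apply: (connected_component_eq _ (cap x (1 - d))) => //.
- by apply: cap_connected => //; lra.
- by split => //; rewrite (x1 : dot x x = 1) gtrBl.
Qed.

End Sphere.

(** * Crossings and corners of a diagram *)

Section Diagrams.
Context {R : realType}.
Implicit Types (D : diagram R) (x y z p : 'rV[R]_3).

Lemma tripleE x y z : triple x y z =
  x 0 0 * (y 0 1 * z 0 2%:R - y 0 2%:R * z 0 1)
  - x 0 1 * (y 0 0 * z 0 2%:R - y 0 2%:R * z 0 0)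
  + x 0 2%:R * (y 0 0 * z 0 1 - y 0 1 * z 0 0).
Proof.
have E (w : 'rV[R]_3) : exists f : nat -> R, forall i, w 0 i = f i.
  by exists (fun n => w 0 (inord n)) => i; rewrite inord_val.
have [[fx Ex] [fy Ey] [fz Ez]] := And3 (E x) (E y) (E z).
rewrite /triple (expand_det_row _ 0) !big_ord_recr big_ord0 /= /cofactor.
rewrite !(expand_det_row _ 0) !big_ord_recr !big_ord0 /= /cofactor !det_mx11 !mxE /=.
by rewrite !Ex !Ey !Ez /= /bump /=; ring.
Qed.

Lemma triple_scale x y a b : triple x (a *: y) (b *: y) = 0.
Proof. by rewrite !tripleE !mxE; ring. Qed.

Lemma normalizeK y : y != 0 -> Num.sqrt (dot y y) *: normalize y = y.
Proof.
move=> y0; rewrite /normalize scalerA mulfV ?scale1r//.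
by rewrite sqrtr_eq0 -ltNge dot_gt0.
Qed.

Lemma triple_normalize x y z : y != 0 -> z != 0 -> normalize y = normalize z ->
  triple x y z = 0.
Proof.
move=> y0 z0 e; rewrite -(normalizeK _ y0) -(normalizeK _ z0) e.
exact: triple_scale.
Qed.

Lemma heading_inj D p q q' :
  fiber (@strand R D) p q -> fiber (@strand R D) p q' ->
  heading q = heading q' -> q = q'.
Proof.
have [_ _ _ f'0 [_ trans _]] := diagram_immersion D.
move=> pq pq' e; apply: contrapT => qq'.
have /eqP[] := trans _ _ _ pq pq' qq'.
by apply: triple_normalize; [exact: f'0|exact: f'0|exact: e].
Qed.

Lemma universeP D p : universe D p <-> exists u, oriented_universe D p u.
Proof.
split=> [[q pq]|[u [q pq _]]]; last by exists q.
by exists (heading q), q.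
Qed.

Lemma crossingsP D p : crossings D p <-> exists u u',
  [/\ oriented_universe D p u, oriented_universe D p u' & u <> u'].
Proof.
split=> [[q [q' [pq pq' qq']]]|[_ [_ [[q pq <-] [q' pq' <-] uu']]]].
  exists (heading q), (heading q'); split; [by exists q|by exists q'|].
  by move=> /heading_inj => /(_ _ pq pq').
exists q, q'; split; [exact: pq|exact: pq'|move=> e; apply: uu'].
exact: (congr1 (@heading R D) e).
Qed.

Lemma crossing_headings D p : crossings D p ->
  over_heading D p <> under_heading D p /\
  forall u, oriented_universe D p u <->
    u = over_heading D p \/ u = under_heading D p.
Proof.
move=> cp; have [q [q' [pq pq' oq uq']]] := diagram_over_under cp.
have qq' : q <> q' by move=> qq'; apply: uq'; rewrite -qq'.
have [_ _ _ _ [three _ _]] := diagram_immersion D.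
have fib r : fiber (@strand R D) p r -> r = q \/ r = q'.
  by move=> pr; have [] := three p q q' r pq pq' pr; auto.
have -> : over_heading D p = heading q.
  apply: xget_unique; first by exists q.
  move=> _ [r [pr our] <-]; have [re|re] := fib r pr; first by rewrite re.
  by exfalso; apply: uq'; rewrite -re.
have -> : under_heading D p = heading q'.
  apply: xget_unique; first by exists q'.
  move=> _ [r [pr our] <-]; have [re|re] := fib r pr; last by rewrite re.
  by exfalso; apply: our; rewrite re.
split; first by move=> /(heading_inj _ _ _ _ pq pq').
move=> u; split=> [[r pr <-]|[->|->]]; last 2 first.
- by exists q.
- by exists q'.
by have [->|->] := fib r pr; [left|right].
Qed.

Lemma universe_closed D : closed (universe D).
Proof.
have [per _ der _ _] := diagram_immersion D.
have -> : universe D = \bigcup_(i in [set: 'I_(ncircles D)]) (@strand R D i @` `[0, 1]).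
  apply/seteqP; split => [p [q [/andP[q0 q1] <-]]|p [i _ [t t01 <-]]].
    exists q.1 => //; exists q.2 => //.
    by rewrite /= in_itv/= q0 ltW.
  move: t01; rewrite /= in_itv/= le_eqVlt => /andP[t0].
  rewrite le_eqVlt => /orP[/eqP ->|t1]; last first.
    by exists (i, t); split; rewrite //= le_eqVlt t0.
  by exists (i, 0); split; rewrite /= ?lexx ?ltr01// -per add0r.
apply: closed_bigcup => [|i _]; first exact: finite_finset.
apply: compact_closed => //; apply: continuous_compact; last exact: segment_compact.
apply: continuous_subspaceT => t.
apply: differentiable_continuous; apply/derivable1_diffP.
exact: (der i 0).
Qed.

Lemma universe_eq D D' :
  (forall p u, oriented_universe D p u <-> oriented_universe D' p u) ->
  universe D = universe D'.
Proof.
move=> DD'; apply/seteqP; split=> p /universeP[u pu]; apply/universeP; exists u.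
  exact/DD'.
exact/DD'.
Qed.

Lemma crossings_oriented D D' p :
  (forall u, oriented_universe D p u <-> oriented_universe D' p u) ->
  crossings D p -> crossings D' p.
Proof.
move=> DD' /crossingsP[u [u' [pu pu' uu']]]; apply/crossingsP; exists u, u'.
by split => //; exact/DD'.
Qed.

Lemma pair_eq {T : Type} (P P' : T -> Prop) (o u o' u' : T) :
  (forall w, P w <-> P' w) ->
  o <> u /\ (forall w, P w <-> w = o \/ w = u) ->
  o' <> u' /\ (forall w, P' w <-> w = o' \/ w = u') ->
  o' = o /\ u' = u \/ o' = u /\ u' = o.
Proof.
move=> PP' [ou H] [ou' H'].
have /PP'/H eo : P' o' by apply/H'; left.
have /PP'/H eu : P' u' by apply/H'; right.
by case: eo eu ou' => -> [] ->; auto.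
Qed.

Lemma over_under_headings D D' p :
  (forall u, oriented_universe D p u <-> oriented_universe D' p u) ->
  crossings D p ->
  over_heading D' p = over_heading D p /\ under_heading D' p = under_heading D p \/
  over_heading D' p = under_heading D p /\ under_heading D' p = over_heading D p.
Proof.
move=> DD' cD; have cD' := crossings_oriented _ _ _ DD' cD.
exact: (pair_eq _ _ _ _ _ _ DD' (crossing_headings _ _ cD)
  (crossing_headings _ _ cD')).
Qed.

(* Stated for arbitrary vectors, because comparing two values of
   [over_heading] up to conversion unfolds real square roots. *)
Definition heading_toward (pos : bool) (o u : 'rV[R]_3) (c : corner) : 'rV[R]_3 :=
  let rising := if pos then u else o in
  let falling := if pos then o else u in
  match c with
  | OutCorner => rising + falling
  | InCorner => - (rising + falling)
  | UpCorner => rising - falling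
  | DownCorner => falling - rising
  end.

Lemma corner_pointE D p c t : corner_point D p c t =
  normalize (p + t *: heading_toward `[< positive_crossing D p >]
    (over_heading D p) (under_heading D p) c).
Proof. by case: c. Qed.

Lemma corner_point_eq D D' p :
  (forall u, oriented_universe D p u <-> oriented_universe D' p u) ->
  crossings D p -> over_heading D p = over_heading D' p ->
  corner_point D p = corner_point D' p /\
  `[< positive_crossing D p >] = `[< positive_crossing D' p >].
Proof.
move=> DD' cD oD; have cD' := crossings_oriented _ _ _ DD' cD.
have uD : under_heading D p = under_heading D' p.
  have [[_ eu]|[eo _]] := over_under_headings _ _ _ DD' cD; first exact: esym eu.
  exact: (False_ind _ (proj1 (crossing_headings _ _ cD) (etrans oD eo))).
have pos : `[< positive_crossing D p >] = `[< positive_crossing D' p >].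
  apply: asbool_equiv_eq; rewrite /positive_crossing.
  move: oD uD; move: (over_heading D p) (under_heading D p) => o u -> ->.
  by split=> -[_ h]; [exact: conj cD' h|exact: conj cD h].
split; last exact: pos.
apply/funext => c; apply/funext => t; rewrite !corner_pointE.
move: oD uD pos; move: (over_heading D p) (under_heading D p) => o u -> ->.
by move=> ->; reflexivity.
Qed.

Lemma negative_not_positive D p : negative_crossing D p -> ~ positive_crossing D p.
Proof. by move=> [_ n] [_ /(lt_trans n)]; rewrite ltxx. Qed.

Lemma corner_point_change D D' p :
  (forall u, oriented_universe D p u <-> oriented_universe D' p u) ->
  positive_crossing D p -> negative_crossing D' p ->
  corner_point D p = corner_point D' p.
Proof.
move=> DD' pD nD'; have [cD trD] := pD; have [_ trD'] := nD'.
apply/funext => c; apply/funext => t; rewrite !corner_pointE.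
rewrite (asboolT pD) (asboolF (negative_not_positive _ _ nD')).
move: trD trD' (over_under_headings _ _ _ DD' cD).
move: (over_heading D p) (under_heading D p) => o u.
move: (over_heading D' p) (under_heading D' p) => o' u' trD trD'.
move=> [[eo eu]|[-> ->]]; first by move: trD'; rewrite eo eu ltNge ltW.
by case: c.
Qed.

Lemma corner_region_eq D D' p : universe D = universe D' ->
  corner_point D p = corner_point D' p -> corner_region D p = corner_region D' p.
Proof. by move=> DD' pp; rewrite /corner_region DD' pp. Qed.

Lemma germ_component (g : R -> 'rV[R]_3) (A : set 'rV[R]_3) :
  (\forall t \near 0^'+, {for t, continuous g}) ->
  (\forall t \near 0^'+, A (g t)) ->
  \forall t \near 0^'+, [set x | \forall s \near 0^'+,
    connected_component A (g s) x] = connected_component A (g t).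
Proof.
move=> cg Ag.
have : \forall t \near 0^'+, {for t, continuous g} /\ A (g t).
  by near=> t; split; near: t.
rewrite {1}/at_right near_withinE => /nbhs_ballP[e /= e0 eA].
have {}eA t : 0 < t < e -> {for t, continuous g} /\ A (g t).
  move=> /andP[t0 te]; apply: eA => //.
  by rewrite /ball /= sub0r normrN gtr0_norm.
have cgA : connected (g @` `]0, e[).
  apply: connected_continuous_connected.
    by apply/connected_intervalP; exact: interval_is_interval.
  apply: continuous_in_subspaceT => t; rewrite inE /= in_itv /= => te.
  by have [] := eA _ te.
have gA : g @` `]0, e[ `<=` A.
  by move=> _ [t + <-]; rewrite /= in_itv /= => /eA[].
have same t s : 0 < t < e -> 0 < s < e ->
    connected_component A (g t) = connected_component A (g s).
  by move=> te se; apply: (connected_component_eq _ _ _ _ cgA gA);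
    [exists t|exists s]; rewrite //= in_itv.
have near_e : \forall s \near 0^'+, 0 < s < e.
  near=> s; apply/andP; split; near: s; first exact: nbhs_right_gt.
  exact: nbhs_right_lt.
apply: filterS (near_e) => t te; apply/seteqP; split => x /=.
  move=> H; have /filter_ex[s [se sx]] :
      \forall s \near 0^'+, 0 < s < e /\ connected_component A (g s) x.
    exact: (filterI near_e H).
  by rewrite (same t s).
by move=> tx; apply: filterS (near_e) => s se; rewrite (same s t).
Unshelve. all: by end_near. Qed.

Lemma corner_point_continuous D p c : sphere p ->
  \forall t \near (0 : R), sphere (corner_point D p c t) /\
    {for t, continuous (corner_point D p c)}.
Proof.
move=> p1.
pose q t := p + t *: corner_heading D p c.
have cq t : {for t, continuous q}.
  rewrite /q; apply: continuousD; first exact: cst_continuous.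
  by apply: continuousZ; [exact: cvg_id|exact: cst_continuous].
have : \forall t \near (0 : R), 0 < dot (q t) (q t).
  have : {for (0 : R), continuous (fun t => dot (q t) (q t))}.
    by apply: continuous_dot; exact: cq.
  by move/cvgr_gt; apply; rewrite /q scale0r addr0 (p1 : dot p p = 1).
apply: filterS => t qt.
have q0 : q t != 0 by rewrite -dot_eq0 gt_eqF.
split; first exact: normalize_sphere.
exact: continuous_normalize.
Qed.

Lemma corner_point0 D p c : sphere p -> corner_point D p c 0 = p.
Proof. by move=> p1; rewrite /corner_point scale0r addr0 normalize_id. Qed.

Lemma corner_point_near D p c (B : set 'rV[R]_3) : sphere p -> closed B ->
  ~ B p -> \forall t \near 0^'+, ~ B (corner_point D p c t).
Proof.
move=> p1 cB Bp; apply: cvg_within.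
have [_ cc] := nbhs_singleton (corner_point_continuous D p c p1).
have /cc : nbhs (corner_point D p c 0) (~` B); last exact.
rewrite corner_point0//.
by apply: open_nbhs_nbhs; split => //; exact: closed_openC.
Qed.

Lemma corner_point_right D p c : sphere p ->
  \forall t \near 0^'+, sphere (corner_point D p c t) /\
    {for t, continuous (corner_point D p c)}.
Proof. by move=> p1; apply: cvg_within; exact: corner_point_continuous. Qed.

Lemma crossing_sphere D p : crossings D p -> sphere p.
Proof.
by have [_ sph _ _ _] := diagram_immersion D; move=> [q [_ [[_ <-] _ _]]].
Qed.

End Diagrams.

(** * Plane charts *)

Lemma connected_pairwise {T : topologicalType} (A : set T) :
  (forall x y, A x -> A y -> exists C, [/\ connected C, C `<=` A, C x & C y]) ->
  connected A.
Proof.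
move=> H; have [->|/set0P[x Ax]] := eqVneq A set0; first exact: connected0.
have -> : A = connected_component A x; last exact: component_connected.
apply/seteqP; split=> [y Ay|]; last exact: connected_component_sub.
have [C [cC CA Cx Cy]] := H x y Ax Ay.
exact: (connected_component_max Cx CA cC).
Qed.

Section Plane.
Context {R : realType}.
Implicit Types (g : R -> R) (F : R * R -> R * R).

Lemma continuous_pair {T : topologicalType} (a b : T -> R) :
  continuous a -> continuous b -> continuous (fun z => (a z, b z)).
Proof.
move=> ca cb z.
exact: (@cvg_pair _ _ _ _ (nbhs (a z)) (nbhs (b z)) _ _ _ a b (ca z) (cb z)).
Qed.

Lemma connected_strip F (I : set R) : continuous F -> is_interval I ->
  connected (F @` [set z | I z.2]).
Proof.
move=> cF iI; apply: connected_pairwise.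
move=> _ _ [[x1 s1] /= I1 <-] [[x2 s2] /= I2 <-].
pose p (t : R) := F ((1 - t) * x1 + t * x2, (1 - t) * s1 + t * s2).
exists (p @` `[0, 1]); split.
- apply: connected_image; last exact: segment_connected.
  move=> t; apply: (@continuous_comp _ _ _ _ F); last exact: cF.
  by apply: continuous_pair => s; apply: cvgD; apply: cvgM;
    try exact: cvg_cst; try exact: cvg_id; apply: cvgB;
    try exact: cvg_cst; exact: cvg_id.
- move=> _ [t + <-]; rewrite /= in_itv/= => /andP[t0 t1].
  eexists; last reflexivity.
  rewrite /=; have [s12|/ltW s21] := leP s1 s2.
    by apply: (iI _ _ I1 I2); apply/andP; split; nra.
  by apply: (iI _ _ I2 I1); apply/andP; split; nra.
- exists 0; first by rewrite /= in_itv/= lexx ler01.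
  by rewrite /p subr0 !mul1r !mul0r !addr0.
- exists 1; first by rewrite /= in_itv/= lexx ler01.
  by rewrite /p subrr !mul1r !mul0r !add0r.
Qed.

Lemma continuous_graph g : continuous g -> continuous (fun z : R * R => g z.1).
Proof. by move=> cg z; apply: continuous_comp; [exact: cvg_fst|exact: cg]. Qed.

Lemma connected_above g : continuous g -> connected [set z : R * R | g z.1 < z.2].
Proof.
move=> cg.
have -> : [set z : R * R | g z.1 < z.2] =
    (fun z => (z.1, g z.1 + z.2)) @` [set z | [set s | 0 < s] z.2].
  apply/seteqP; split=> [[x y] /= xy|_ [[x s] /= s0 <-]] /=; last by lra.
  by exists (x, y - g x); rewrite /= ?subr_gt0// addrC subrK.
apply: connected_strip; last by move=> a b /= a0 _ c /andP[ac _]; lra.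
apply: continuous_pair => z; first exact: cvg_fst.
by apply: cvgD; [exact: continuous_graph|exact: cvg_snd].
Qed.

Lemma connected_below g : continuous g -> connected [set z : R * R | g z.1 < - z.2].
Proof.
move=> cg.
have -> : [set z : R * R | g z.1 < - z.2] =
    (fun z => (z.1, - z.2)) @` [set z : R * R | g z.1 < z.2].
  apply/seteqP; split=> [[x y] /= xy|_ [[x s] /= s0 <-]] /=; last by rewrite opprK.
  by exists (x, - y); rewrite //= opprK.
apply: connected_image; last exact: connected_above.
apply: continuous_pair => z; first exact: cvg_fst.
by apply: cvgN; exact: cvg_snd.
Qed.

Lemma connected_swap (A : set (R * R)) : connected A ->
  connected [set z | A (z.2, z.1)].
Proof.
move=> cA.
have -> : [set z | A (z.2, z.1)] = (fun z => (z.2, z.1)) @` A.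
  apply/seteqP; split=> [[x y] /= xy|_ [[x y] /= s0 <-]] //.
  by exists (y, x).
apply: connected_image => //.
by apply: continuous_pair => z; [exact: cvg_snd|exact: cvg_fst].
Qed.

Lemma connected_between g : continuous g -> (forall x, 0 < g x) ->
  connected [set z : R * R | `|z.2| < g z.1].
Proof.
move=> cg g0.
have -> : [set z : R * R | `|z.2| < g z.1] =
    (fun z => (z.1, g z.1 * z.2)) @` [set z | [set s | `|s| < 1] z.2].
  apply/seteqP; split=> [[x y] /= xy|_ [[x s] /= s1 <-]] /=.
    exists (x, y / g x); rewrite /=.
      by rewrite normrM normfV (gtr0_norm (g0 x)) ltr_pdivrMr// mul1r.
    by congr (_, _); rewrite mulrCA mulfV ?mulr1// gt_eqF.
  by rewrite normrM (gtr0_norm (g0 x)) gtr_pMr.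
apply: connected_strip.
  apply: continuous_pair => z; first exact: cvg_fst.
  by apply: cvgM; [exact: continuous_graph|exact: cvg_snd].
move=> a b /=; rewrite !ltr_norml => /andP[a1 a2] /andP[b1 b2] c /andP[ac cb].
by rewrite ltr_norml; apply/andP; split; lra.
Qed.

Lemma quadrant_connected c : connected (@quadrant R c).
Proof.
have cn : continuous (fun x : R => `|x|) by move=> x; exact: norm_continuous.
case: c; rewrite /quadrant.
- exact: (connected_swap _ (connected_above _ cn)).
- exact: (connected_swap _ (connected_below _ cn)).
- exact: (connected_above _ cn).
- exact: (connected_below _ cn).
Qed.

Lemma open_continuous_lt (a b : R * R -> R) : continuous a -> continuous b ->
  open [set z | a z < b z].
Proof.
move=> ca cb.
have -> : [set z | a z < b z] = (fun z => b z - a z) @^-1` [set r | 0 < r].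
  by apply/seteqP; split=> z; rewrite /= subr_gt0.
apply: open_comp; last exact: open_gt.
by move=> z _; apply: cvgB; [exact: cb|exact: ca].
Qed.

Lemma box_closed_image (h : R * R -> 'rV[R]_3) : continuous h -> closed (h @` box).
Proof.
move=> ch; apply: compact_closed => //; apply: continuous_compact.
  exact: continuous_subspaceT.
have -> : @box R = `[-1, 1] `*` `[-1, 1].
  by apply/seteqP; split=> -[x y]; rewrite /box /= !in_itv /= !ler_norml.
by apply: compact_setX; exact: segment_compact.
Qed.

End Plane.

(** * Regions under a local smoothing *)

Definition components {T : topologicalType} (A : set T) : set (set T) :=
  [set connected_component A x | x in A].

Definition local_smoothing {R : realType} (U U0 : set 'rV[R]_3)
    (h : R * R -> 'rV[R]_3) (g : R -> R) : Prop :=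
  [/\ open_embedding h,
      closed U /\ closed U0,
      h @^-1` U = [set z | `|z.2| = `|z.1|] /\
      h @^-1` U0 = [set z | `|z.2| = g z.1],
      [/\ continuous g, forall x, 0 < g x & forall x, 1 <= `|x| -> g x = `|x|] &
      forall p, ~ (h @` box) p -> (U p <-> U0 p)].

Section LocalSmoothing.
Context {R : realType} {U U0 : set 'rV[R]_3} {h : R * R -> 'rV[R]_3} {g : R -> R}.
Hypothesis sm : local_smoothing U U0 h g.

Let emb : open_embedding h. Proof. by case: sm. Qed.
Let closedU : closed U. Proof. by case: sm => _ []. Qed.
Let closedU0 : closed U0. Proof. by case: sm => _ []. Qed.
Let hU : h @^-1` U = [set z | `|z.2| = `|z.1|].
Proof. by case: sm => _ _ []. Qed.
Let hU0 : h @^-1` U0 = [set z | `|z.2| = g z.1].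
Proof. by case: sm => _ _ []. Qed.
Let cg : continuous g. Proof. by case: sm => _ _ _ []. Qed.
Let g_gt0 x : 0 < g x. Proof. by case: sm => _ _ _ []. Qed.
Let g_out x : 1 <= `|x| -> g x = `|x|.
Proof. by case: sm => _ _ _ [_ _ out] _; exact: out. Qed.
Let UU0 p : ~ (h @` box) p -> (U p <-> U0 p). 
Proof. by case: sm => _ _ _ _ out; exact: out. Qed.

Let B := h @` box.
Let X := sphere `\` U.
Let X0 := sphere `\` U0.

Lemma continuous_chart : continuous h. Proof. by case: emb. Qed.

Lemma chart_inj : injective h. Proof. by case: emb. Qed.

Lemma chart_sphere w : sphere (h w).
Proof. by case: emb => _ _ sub _; apply: sub; exists w. Qed.

Lemma closed_chart_box : closed B.
Proof. exact: box_closed_image continuous_chart. Qed.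

Lemma UhE w : U (h w) <-> `|w.2| = `|w.1|.
Proof. by move: hU => /seteqP[a b]; split=> [/a|/b]. Qed.

Lemma U0hE w : U0 (h w) <-> `|w.2| = g w.1.
Proof. by move: hU0 => /seteqP[a b]; split=> [/a|/b]. Qed.

Lemma g_le1 x : `|x| <= 1 -> g x <= 1.
Proof.
move=> x1; rewrite leNgt; apply/negP => gx.
have nB : ~ B (h (x, g x)).
  move=> [[y s] [/= _ s1] /chart_inj[_ s2]].
  by move: s1; rewrite s2 gtr0_norm// leNgt gx.
have : U (h (x, g x)).
  by apply/(UU0 _ nB)/U0hE; rewrite /= gtr0_norm.
by move/UhE => /= e; move: x1; rewrite -e gtr0_norm// leNgt gx.
Qed.

Definition smooth_quadrant (c : corner) : set (R * R) :=
  match c with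
  | OutCorner | InCorner => [set z | `|z.2| < g z.1]
  | UpCorner => [set z | g z.1 < z.2]
  | DownCorner => [set z | g z.1 < - z.2]
  end.

Lemma smooth_quadrant_connected c : connected (smooth_quadrant c).
Proof.
by case: c; [exact: connected_between|exact: connected_between
  |exact: connected_above|exact: connected_below].
Qed.

Lemma quadrant_open c : open (@quadrant R c).
Proof.
have cn (f : R * R -> R) : continuous f -> continuous (fun z => `|f z|).
  by move=> cf z; apply: continuous_comp; [exact: cf|exact: norm_continuous].
have cN (f : R * R -> R) : continuous f -> continuous (fun z => - f z).
  by move=> cf z; apply: cvgN; exact: cf.
have c1 : continuous (fun z : R * R => z.1) by move=> z; exact: cvg_fst.
have c2 : continuous (fun z : R * R => z.2) by move=> z; exact: cvg_snd.
by case: c => /=; apply: open_continuous_lt; auto.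
Qed.

Lemma smooth_quadrant_open c : open (smooth_quadrant c).
Proof.
have cn (f : R * R -> R) : continuous f -> continuous (fun z => `|f z|).
  by move=> cf z; apply: continuous_comp; [exact: cf|exact: norm_continuous].
have cN (f : R * R -> R) : continuous f -> continuous (fun z => - f z).
  by move=> cf z; apply: cvgN; exact: cf.
have c1 : continuous (fun z : R * R => g z.1) by exact: continuous_graph.
have c2 : continuous (fun z : R * R => z.2) by move=> z; exact: cvg_snd.
by case: c => /=; apply: open_continuous_lt; auto.
Qed.

Definition corner_sample (c : corner) : R * R :=
  match c with
  | OutCorner => (2, 0) | InCorner => (- 2, 0)
  | UpCorner => (0, 2) | DownCorner => (0, - 2)
  end.

Definition quadrant_of (w : R * R) : corner :=
  if `|w.2| < w.1 then OutCorner else if `|w.2| < - w.1 then InCorner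
  else if 0 < w.2 then UpCorner else DownCorner.

Definition smooth_quadrant_of (w : R * R) : corner :=
  if `|w.2| < g w.1 then OutCorner
  else if 0 < w.2 then UpCorner else DownCorner.

Lemma corner_sample_quadrant c : quadrant c (corner_sample c).
Proof. by case: c; rewrite /= normr0 ?opprK. Qed.

Lemma corner_sample_smooth c : smooth_quadrant c (corner_sample c).
Proof.
have g0 : g 0 <= 1 by apply: g_le1; rewrite normr0.
by case: c; rewrite /= ?normr0 ?opprK//; lra.
Qed.

Lemma corner_sample_box c : ~ B (h (corner_sample c)).
Proof.
move=> [[x y] [/= x1 y1] /chart_inj e].
case: c e => -[ex ey]; move: x1 y1; rewrite ex ey ?normrN !ger0_norm//; lra.
Qed.

Lemma quadrant_ofP w : ~ U (h w) -> quadrant (quadrant_of w) w.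
Proof.
rewrite UhE /quadrant_of; case: w => x y /= xy.
case: ifP => //= /negbT; rewrite -leNgt => a.
case: ifP => //= /negbT; rewrite -leNgt => b.
have xy' : `|x| < `|y|.
  rewrite lt_def; apply/andP; split; first by apply/eqP.
  by rewrite ler_norml; apply/andP; split => //; lra.
case: ifP => /= [y0|/negbT]; first by rewrite (gtr0_norm y0) in xy'.
by rewrite -leNgt => y0; rewrite (ler0_norm y0) in xy'.
Qed.

Lemma quadrant_of_eq c w : quadrant c w -> quadrant_of w = c.
Proof.
rewrite /quadrant_of; case: w => x y; case: c => /=.
- by move=> ->.
- move=> yx; rewrite yx ifF//; apply/negbTE; rewrite -leNgt.
  by have := normr_ge0 y; lra.
- move=> xy; have y0 : 0 < y by have := normr_ge0 x; lra.
  have := ler_norm x; have := ler_norm (- x); rewrite normrN (gtr0_norm y0) => a b.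
  have e1 : (y < x) = false by apply/negbTE; rewrite -leNgt; lra.
  have e2 : (y < - x) = false by apply/negbTE; rewrite -leNgt; lra.
  by rewrite e1 e2 y0.
- move=> xy; have y0 : y < 0 by have := normr_ge0 x; lra.
  have := ler_norm x; have := ler_norm (- x); rewrite normrN (ltr0_norm y0) => a b.
  have e1 : (- y < x) = false by apply/negbTE; rewrite -leNgt; lra.
  have e2 : (- y < - x) = false by apply/negbTE; rewrite -leNgt; lra.
  by rewrite e1 e2 ltNge (ltW y0).
Qed.

Lemma smooth_quadrant_ofP w :
  ~ U0 (h w) -> smooth_quadrant (smooth_quadrant_of w) w.
Proof.
rewrite U0hE /smooth_quadrant_of; case: w => x y /= xy.
case: ifP => //= /negbT; rewrite -leNgt => a.
have xy' : g x < `|y| by rewrite lt_def a andbT; apply/eqP.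
case: ifP => /= [y0|/negbT]; first by rewrite (gtr0_norm y0) in xy'.
by rewrite -leNgt => y0; rewrite (ler0_norm y0) in xy'.
Qed.

Lemma smooth_quadrant_of_eq w w' :
  smooth_quadrant (smooth_quadrant_of w) w' ->
  smooth_quadrant_of w' = smooth_quadrant_of w.
Proof.
rewrite {1 3}/smooth_quadrant_of; have gw := g_gt0 w'.1; case: ifP => _ /=.
  by rewrite /smooth_quadrant_of => ->.
case: ifP => _ /=; rewrite /smooth_quadrant_of => gy.
  have y0 : 0 < w'.2 by lra.
  by rewrite gtr0_norm// y0 ltNge ltW.
have y0 : w'.2 < 0 by lra.
by rewrite ltr0_norm// ltNge (ltW gy) /= ltNge ltW.
Qed.

Definition retract (q : R * R -> corner) (z : 'rV[R]_3) : 'rV[R]_3 :=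
  if `[< range h z >] then h (corner_sample (q (xget 0 (h @^-1` [set z])))) else z.

Lemma retract_chart q w : retract q (h w) = h (corner_sample (q w)).
Proof.
rewrite /retract asboolT; last by exists w.
congr (h (corner_sample (q _))); apply: xget_unique => //= y.
exact: chart_inj.
Qed.

Lemma retract_out q z : ~ range h z -> retract q z = z.
Proof. by move=> hz; rewrite /retract asboolF. Qed.

Lemma retract_locally_constant {T : Type} (A A' : set 'rV[R]_3)
    (Q : corner -> set (R * R)) (q : R * R -> corner) (f : 'rV[R]_3 -> T) :
  A' `<=` sphere -> (forall c, open (Q c)) ->
  (forall w, A' (h w) -> Q (q w) w) ->
  (forall w w', Q (q w) w' -> q w' = q w) ->
  (forall x, A x -> \forall y \near x, A y -> f y = f x) ->
  (forall z, A' z -> ~ B z -> A z /\ f (retract q z) = f z) ->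
  forall x, A' x -> \forall y \near x, A' y -> f (retract q y) = f (retract q x).
Proof.
move=> A'S Qo A'Q Qq lf out x A'x.
have [Bx|Bx] := pselect (B x); last first.
  have [Ax fx] := out x A'x Bx.
  have nB : \forall y \near x, ~ B y.
    apply: open_nbhs_nbhs; split => //.
    by apply: closed_openC; exact: closed_chart_box.
  near=> y => A'y.
  have By : ~ B y by near: y.
  have [Ay fy] := out y A'y By; rewrite fx fy.
  by move: Ay; near: y; exact: lf.
move: Bx A'x => [w _ <-] A'w.
have [_ _ _ openh] := emb; have [V oV QV] := openh _ (Qo (q w)).
have Vw : V (h w).
  have : (h @` Q (q w)) (h w) by exists w => //; exact: A'Q.
  by rewrite QV => -[].
have : nbhs (h w) V by apply: open_nbhs_nbhs.
apply: filterS => y Vy A'y.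
have : (h @` Q (q w)) y by rewrite QV; split => //; exact: A'S.
by move=> [w' Qw' <-]; rewrite !retract_chart (Qq _ _ Qw').
Unshelve. all: by end_near. Qed.

Lemma outside_box z : ~ B z -> X z <-> X0 z.
Proof. by move=> nB; have [a b] := UU0 _ nB; split=> -[? n]; split; auto. Qed.

Lemma quadrant_smooth c w : ~ box w -> quadrant c w -> smooth_quadrant c w.
Proof.
case: w => x y nb q.
have gx : `|x| <= 1 -> g x <= 1 /\ 1 < `|y|.
  move=> x1; split; first exact: g_le1.
  by rewrite ltNge; apply/negP => y1; exact: nb.
have gx' : 1 <= `|x| -> g x = `|x| := g_out x.
have := ler_norm x; have := ler_norm (- x); rewrite normrN => xn1 xn2.
have := ler_norm y; have := ler_norm (- y); rewrite normrN => yn1 yn2.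
case: c q => /= q; have [x1|/ltW x1] := leP `|x| 1;
  try (by have [] := gx x1; lra); try (by have := gx' x1; lra).
- have [_ y1] := gx x1; have y0 : 0 < y by have := normr_ge0 x; lra.
  by rewrite gtr0_norm// in y1; have [] := gx x1; lra.
- have [_ y1] := gx x1; have y0 : y < 0 by have := normr_ge0 x; lra.
  by rewrite ltr0_norm// in y1; have [] := gx x1; lra.
Qed.

Lemma smooth_quadrant_out c w : ~ box w -> smooth_quadrant c w ->
  quadrant c w \/ ~~ side_corner c /\ (quadrant InCorner w \/ quadrant OutCorner w).
Proof.
case: w => x y nb q.
have nb' : `|x| <= 1 -> 1 < `|y|.
  by move=> x1; rewrite ltNge; apply/negP => y1; exact: nb.
have gx0 := g_gt0 x; have gx1 := g_le1 x; have gx2 := g_out x.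
have lr : `|y| < g x -> `|y| < - x \/ `|y| < x.
  move=> yg; have [x1|x1] := leP `|x| 1.
    by have := nb' x1; have := gx1 x1; lra.
  rewrite (gx2 (ltW x1)) in yg; have [x0|x0] := leP 0 x.
    by right; rewrite (ger0_norm x0) in yg.
  by left; rewrite (ltr0_norm x0) in yg.
have xlt y' : `|y'| = `|y| -> g x < y' -> `|x| < y'.
  move=> yy gy; have y0 : 0 < y' by lra.
  have [x1|/ltW x1] := leP `|x| 1; last by rewrite -gx2.
  by have := nb' x1; rewrite -yy gtr0_norm//; lra.
case: c q => /= q.
- by right; split => //; exact: lr.
- by right; split => //; exact: lr.
- by left; exact: xlt.
- by left; apply: xlt => //; rewrite normrN.
Qed.

Lemma quadrant_off_universe c w : quadrant c w -> X (h w).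
Proof.
move=> qw; split; first exact: chart_sphere.
rewrite UhE; case: w qw => x y; case: c => /= q; apply/eqP.
- by have := ler_norm x; lra.
- by have := ler_norm (- x); rewrite normrN; lra.
- by have := ler_norm y; lra.
- by have := ler_norm (- y); rewrite normrN; lra.
Qed.

Lemma smooth_quadrant_off_universe c w : smooth_quadrant c w -> X0 (h w).
Proof.
move=> qw; split; first exact: chart_sphere.
rewrite U0hE; case: w qw => x y; have gx := g_gt0 x; case: c => /= q; apply/eqP.
- by lra.
- by lra.
- by have := ler_norm y; lra.
- by have := ler_norm (- y); rewrite normrN; lra.
Qed.

Lemma component_quadrant c w : quadrant c w ->
  connected_component X (h w) = connected_component X (h (corner_sample c)).
Proof.
move=> qw; apply: (connected_component_eq _ (h @` quadrant c)).
- exact: (connected_image _ _ continuous_chart (quadrant_connected c)).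
- by move=> _ [w' qw' <-]; exact: quadrant_off_universe qw'.
- by exists w.
- by exists (corner_sample c) => //; exact: corner_sample_quadrant.
Qed.

Lemma component_smooth_quadrant c w : smooth_quadrant c w ->
  connected_component X0 (h w) = connected_component X0 (h (corner_sample c)).
Proof.
move=> qw; apply: (connected_component_eq _ (h @` smooth_quadrant c)).
- exact: (connected_image _ _ continuous_chart (smooth_quadrant_connected c)).
- by move=> _ [w' qw' <-]; exact: smooth_quadrant_off_universe qw'.
- by exists w.
- by exists (corner_sample c) => //; exact: corner_sample_smooth.
Qed.

Lemma box_chart w : ~ B (h w) -> ~ box w.
Proof. by move=> nB bw; apply: nB; exists w. Qed.

Lemma component_retract z : X z -> ~ B z ->
  connected_component X0 (retract quadrant_of z) = connected_component X0 z.
Proof.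
move=> Xz nB; have [[w _ wz]|hz] := pselect (range h z); last by rewrite retract_out.
move: Xz nB; rewrite -{}wz => -[_ Uw] /box_chart nb; rewrite retract_chart.
rewrite -(component_smooth_quadrant (quadrant_of w) w)//.
by apply: quadrant_smooth => //; exact: quadrant_ofP.
Qed.

Lemma smoothing_component x y : ~ B x -> ~ B y -> connected_component X x y ->
  connected_component X0 x = connected_component X0 y.
Proof.
move=> nx ny xy; have [Xx Xy _] := connected_componentP _ _ _ xy.
rewrite -(component_retract x)// -(component_retract y)//.
have lc : forall z, X z -> \forall t \near z, X t ->
    connected_component X0 (retract quadrant_of t) =
    connected_component X0 (retract quadrant_of z).
  apply: (@retract_locally_constant _ X0 X (@quadrant R)).
  - by move=> z [].
  - exact: quadrant_open.
  - by move=> w [_]; exact: quadrant_ofP.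
  - by move=> w w'; exact: quadrant_of_eq.
  - by move=> z; exact: sphere_component_open.
  - by move=> z Xz nz; split; [exact/outside_box|exact: component_retract].
apply: (connected_locally_constant (connected_component X x)
  (fun z => connected_component X0 (retract quadrant_of z))) => //.
- exact: component_connected.
- move=> z /connected_component_sub Xz.
  by apply: filterS (lc z Xz) => t H /connected_component_sub; exact: H.
- exact: connected_component_refl.
Qed.

Let in_region := connected_component X (h (corner_sample InCorner)).
Let out_region := connected_component X (h (corner_sample OutCorner)).

Definition merged_component (z : 'rV[R]_3) : set 'rV[R]_3 :=
  if `[< connected_component X z = in_region >] then out_region
  else connected_component X z.

Lemma merged_retract z : X0 z -> ~ B z ->
  merged_component (retract smooth_quadrant_of z) = merged_component z.
Proof.
move=> Xz nB; have [[w _ wz]|hz] := pselect (range h z); last by rewrite retract_out.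
move: Xz nB; rewrite -{}wz => -[_ Uw] /box_chart nb; rewrite retract_chart.
have [qw|[side qw]] := smooth_quadrant_out _ _ nb (smooth_quadrant_ofP _ Uw).
  by rewrite /merged_component (component_quadrant _ _ qw).
have -> : smooth_quadrant_of w = OutCorner.
  by move: side; rewrite /smooth_quadrant_of; case: ifP => //; case: ifP.
rewrite /merged_component -/out_region.
have -> : (if `[< out_region = in_region >] then out_region else out_region) = out_region.
  by case: ifP.
case: qw => qw; rewrite (component_quadrant _ _ qw).
  by rewrite asboolT.
by rewrite -/out_region; case: ifP.
Qed.

Lemma unsmoothing_component x y : ~ B x -> ~ B y -> connected_component X0 x y ->
  merged_component x = merged_component y.
Proof.
move=> nx ny xy; have [Xx Xy _] := connected_componentP _ _ _ xy.
rewrite -(merged_retract x)// -(merged_retract y)//.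
have lc : forall z, X0 z -> \forall t \near z, X0 t ->
    merged_component (retract smooth_quadrant_of t) =
    merged_component (retract smooth_quadrant_of z).
  apply: (@retract_locally_constant _ X X0 smooth_quadrant).
  - by move=> z [].
  - exact: smooth_quadrant_open.
  - by move=> w [_]; exact: smooth_quadrant_ofP.
  - by move=> w w'; exact: smooth_quadrant_of_eq.
  - move=> z Xz; apply: filterS (sphere_component_open _ _ closedU Xz) => t H Xt.
    by rewrite /merged_component (H Xt).
  - by move=> z Xz nz; split; [exact/outside_box|exact: merged_retract].
apply: (connected_locally_constant (connected_component X0 x)
  (fun z => merged_component (retract smooth_quadrant_of z))) => //.
- exact: component_connected.
- move=> z /connected_component_sub Xz.
  by apply: filterS (lc z Xz) => t H /connected_component_sub; exact: H.
- exact: connected_component_refl.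
Qed.

Lemma region_outside_box r : components X r ->
  exists y, [/\ X y, ~ B y & r = connected_component X y].
Proof.
move=> [z Xz <-]; have [nB|/contrapT Bz] := pselect (~ B z); first by exists z.
case: Bz Xz => w _ <- [_ Uw]; exists (h (corner_sample (quadrant_of w))); split.
- exact: (quadrant_off_universe _ _ (corner_sample_quadrant _)).
- exact: corner_sample_box.
- exact: component_quadrant (quadrant_ofP _ Uw).
Qed.

Lemma smooth_region_outside_box r : components X0 r ->
  exists y, [/\ X0 y, ~ B y & r = connected_component X0 y].
Proof.
move=> [z Xz <-]; have [nB|/contrapT Bz] := pselect (~ B z); first by exists z.
case: Bz Xz => w _ <- [_ Uw]; exists (h (corner_sample (smooth_quadrant_of w))); split.
- exact: (smooth_quadrant_off_universe _ _ (corner_sample_smooth _)).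
- exact: corner_sample_box.
- exact: component_smooth_quadrant (smooth_quadrant_ofP _ Uw).
Qed.

Definition smoothed (r : set 'rV[R]_3) : set 'rV[R]_3 :=
  [set z | exists2 w, r w & ~ B w /\ connected_component X0 w z].

Lemma smoothed0 : smoothed set0 = set0.
Proof. by apply/seteqP; split => z // -[]. Qed.

Lemma smoothed_component y : X y -> ~ B y ->
  smoothed (connected_component X y) = connected_component X0 y.
Proof.
move=> Xy nB; apply/seteqP; split=> z.
  by move=> [w yw [nw]]; rewrite (smoothing_component _ _ nB nw yw).
by move=> yz; exists y; [exact: connected_component_refl|split].
Qed.

Lemma smoothed_region r : components X r -> components X0 (smoothed r).
Proof.
move=> /region_outside_box[y [Xy nB ->]]; rewrite smoothed_component//.
by exists y => //; exact/outside_box.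
Qed.

Lemma smoothed_surj F : components X0 F ->
  exists2 r, components X r & smoothed r = F.
Proof.
move=> /smooth_region_outside_box[y [X0y nB ->]].
have Xy : X y by exact/outside_box.
by exists (connected_component X y); [exists y|rewrite smoothed_component].
Qed.

Lemma smoothed_eq r r' : components X r -> components X r' ->
  smoothed r = smoothed r' ->
  r = r' \/ (r = in_region \/ r = out_region) /\ (r' = in_region \/ r' = out_region).
Proof.
move=> /region_outside_box[y [Xy nB ->]] /region_outside_box[y' [Xy' nB' ->]].
rewrite !smoothed_component// => e.
have yy' : connected_component X0 y y'.
  by rewrite e; apply: connected_component_refl; exact/outside_box.
have := unsmoothing_component _ _ nB nB' yy'; rewrite /merged_component.
by case: asboolP => a; case: asboolP => b; auto.
Qed.

Lemma smoothed_merge : smoothed in_region = smoothed out_region.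
Proof.
rewrite !smoothed_component//; try exact: corner_sample_box;
  try exact: (quadrant_off_universe _ _ (corner_sample_quadrant _)).
exact: (component_smooth_quadrant OutCorner _ (corner_sample_smooth InCorner)).
Qed.

Lemma smoothed_meet r F : components X r -> components X0 F ->
  ((r `&` F) `\` B !=set0) <-> F = smoothed r.
Proof.
move=> /region_outside_box[y [Xy nB ->]] [x X0x <-]; rewrite smoothed_component//.
split=> [[z [[yz xz] nz]]|xy].
  rewrite (smoothing_component _ _ nB nz yz).
  by have [] := connected_componentP _ _ _ xz.
exists y; split=> //; split; first exact: connected_component_refl.
by rewrite xy; apply: connected_component_refl; exact/outside_box.
Qed.

Definition germ_region (A : set 'rV[R]_3) (p : R -> 'rV[R]_3) : set 'rV[R]_3 :=
  [set x | \forall t \near 0^'+, connected_component A (p t) x].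

Lemma germ_region_neq0 A p :
  germ_region A p !=set0 -> \forall t \near 0^'+, A (p t).
Proof.
move=> [x]; apply: filterS => t.
by move=> /connected_componentP[].
Qed.

Lemma smoothed_germ p :
  (\forall t \near 0^'+, {for t, continuous p}) ->
  (\forall t \near 0^'+, ~ B (p t)) ->
  germ_region X0 p = smoothed (germ_region X p).
Proof.
move=> cp nB.
have [Xp|Xp] := pselect (\forall t \near 0^'+, X (p t)).
  have X0p : \forall t \near 0^'+, X0 (p t).
    near=> t; have nBt : ~ B (p t) by near: t.
    by apply/outside_box => //; near: t.
  have : \forall t \near 0^'+, [/\ X (p t), ~ B (p t),
      germ_region X p = connected_component X (p t) &
      germ_region X0 p = connected_component X0 (p t)].
    near=> t; split; near: t; [exact: Xp|exact: nB|exact: germ_component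
      |exact: germ_component].
  by move=> /filter_ex[t [Xt nt -> ->]]; rewrite smoothed_component.
have e : germ_region X p = set0.
  by apply: contra_notP Xp => /eqP/set0P; exact: germ_region_neq0.
rewrite e smoothed0; apply: contra_notP Xp => /eqP/set0P/germ_region_neq0 X0p.
near=> t; have nBt : ~ B (p t) by near: t.
by apply/outside_box => //; near: t.
Unshelve. all: by end_near. Qed.

Lemma quadrant_germ c p :
  (\forall t \near 0^'+, {for t, continuous p}) ->
  (\forall t \near 0^'+, (h @` quadrant c) (p t)) ->
  germ_region X p = connected_component X (h (corner_sample c)).
Proof.
move=> cp qp.
have Xp : \forall t \near 0^'+, X (p t).
  by apply: filterS (qp) => t [w qw <-]; exact: quadrant_off_universe qw.
have /filter_ex[t [[w qw wt] ->]] :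
    \forall t \near 0^'+, (h @` quadrant c) (p t) /\
      germ_region X p = connected_component X (p t).
  exact: filterI qp (germ_component _ _ cp Xp).
by rewrite -wt; exact: component_quadrant.
Qed.

Lemma germ_region_region p :
  (\forall t \near 0^'+, {for t, continuous p}) -> germ_region X p !=set0 ->
  components X (germ_region X p).
Proof.
move=> cp /germ_region_neq0 Xp.
have /filter_ex[t [Xt ->]] : \forall t \near 0^'+, X (p t) /\
    germ_region X p = connected_component X (p t).
  exact: filterI Xp (germ_component _ _ cp Xp).
by exists (p t).
Qed.

Lemma smoothed_neq0 r : smoothed r !=set0 -> r !=set0.
Proof. by move=> [z [w rw _]]; exists w. Qed.

End LocalSmoothing.

Arguments smoothed {R} U0 h r _.

(** * States *)

Lemma finite_card_setD1 {T : choiceType} (A : set T) (a : T) :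
  finite_set A -> A a -> ~ (A #<= A `\ a).
Proof.
move=> /finite_fsetP[X ->] Xa; rewrite -set_fsetD1.
have XI := introT card_eq_fsetP (erefl #|` X|).
have YI := introT card_eq_fsetP (erefl #|` (X `\ a)%fset|).
rewrite (card_le_eql XI) (card_le_eqr YI) card_le_II.
by rewrite (cardfsD1 a X) Xa ltnn.
Qed.

Lemma finite_subsets {T : choiceType} (A : set T) :
  finite_set A -> finite_set [set M | M `<=` A].
Proof.
move=> /finite_fsetP[X ->].
have : finite_set ((fun Y : {fset T} => [set` Y]) @` [set` fpowerset X]).
  exact: finite_image.
apply: sub_finite_set => M MX.
have fM : finite_set M by apply: sub_finite_set MX _; exact: finite_fset.
exists (fset_set M); last by rewrite fset_setK.
rewrite /= fpowersetE; apply/fsubsetP => x.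
by rewrite in_fset_set// inE => /MX.
Qed.

Section States.
Context {T : choiceType} {K : Type}.
Notation marker := (T * corner)%type.

Definition marker_states (C : set T) (S : set K) (k : marker -> K) :
    set (set marker) :=
  [set M | [/\ forall m, M m -> C m.1 /\ S (k m),
               forall r, S r -> exists! m, M m /\ k m = r &
               forall p, C p -> exists! m, M m /\ m.1 = p]].

Lemma marker_states_finite C S k : finite_set C -> finite_set (marker_states C S k).
Proof.
move=> fC; have : finite_set [set M : set marker | M `<=` C `*` [set: corner]].
  by apply: finite_subsets; apply: finite_setX => //; exact: finite_finset.
by apply: sub_finite_set => M [MC _ _] m /MC[Cm _].
Qed.

Lemma state_finite C S k M : finite_set C -> marker_states C S k M -> finite_set M.
Proof.
move=> fC [MC _ _]; have : finite_set (C `*` [set: corner]).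
  by apply: finite_setX => //; exact: finite_finset.
by apply: sub_finite_set => m /MC[Cm _].
Qed.

Section OneState.
Variables (C : set T) (S : set K) (k : marker -> K) (M : set marker).
Hypothesis MS : marker_states C S k M.

Lemma state_crossing_inj m m' : M m -> M m' -> m.1 = m'.1 -> m = m'.
Proof.
have [MC _ MT] := MS => Mm Mm' e; have [Cm _] := MC _ Mm.
by have [m0 [_ u]] := MT _ Cm; rewrite -(u m)// (u m').
Qed.

Lemma state_region_inj m m' : M m -> M m' -> k m = k m' -> m = m'.
Proof.
have [MC MR _] := MS => Mm Mm' e; have [_ Sm] := MC _ Mm.
by have [m0 [_ u]] := MR _ Sm; rewrite -(u m)// (u m').
Qed.

End OneState.

End States.

Lemma marker_states_ext {T : choiceType} {K : Type} (C : set T) (S : set K)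
    (k k' : T * corner -> K) :
  (forall m, C m.1 -> k m = k' m) -> marker_states C S k = marker_states C S k'.
Proof.
suff sub (f f' : T * corner -> K) : (forall m, C m.1 -> f m = f' m) ->
    marker_states C S f `<=` marker_states C S f'.
  by move=> e; apply/seteqP; split; apply: sub => // m Cm; rewrite e.
move=> e M [MC MR MT]; split=> // [m Mm|r Sr].
  by have [Cm Sm] := MC _ Mm; rewrite -e.
have [m [[Mm mr] u]] := MR _ Sr; have [Cm _] := MC _ Mm.
exists m; split; first by rewrite -e.
by move=> m' [Mm']; have [Cm' _] := MC _ Mm'; rewrite -e// => m'r; exact: u.
Qed.

Section Smoothing.
Context {T : choiceType} {K K0 : Type}.
Notation marker := (T * corner)%type.
Context (C : set T) (v : T) (S : set K) (S0 : set K0).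
Context (k : marker -> K) (k0 : marker -> K0) (phi : K -> K0).

Definition merged_corner (c : corner) : bool := ~~ side_corner c.

Definition opposite (c : corner) : corner :=
  match c with
  | OutCorner => InCorner | InCorner => OutCorner
  | UpCorner => DownCorner | DownCorner => UpCorner
  end.

Definition merged_region (r : K) : Prop := exists2 c, merged_corner c & r = k (v, c).

Hypothesis Cv : C v.
Hypothesis k0E : forall m, C m.1 -> m.1 <> v -> k0 m = phi (k m).
Hypothesis phi_surj : forall F, S0 F -> exists2 r, S r & phi r = F.
Hypothesis phi_eq : forall r r', S r -> S r' -> phi r = phi r' ->
  r = r' \/ merged_region r /\ merged_region r'.
Hypothesis phi_merged : phi (k (v, InCorner)) = phi (k (v, OutCorner)).
Hypothesis phi_unmerged : forall r, S r -> ~ merged_region r -> S0 (phi r).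
Hypothesis phi_S : forall m, C m.1 -> m.1 <> v -> S0 (phi (k m)) -> S (k m).
Hypothesis S0_merged : S0 (phi (k (v, OutCorner))) <->
  S (k (v, InCorner)) /\ S (k (v, OutCorner)).
Hypothesis S_merged : S (k (v, InCorner)) \/ S (k (v, OutCorner)).
Hypothesis k_distinct : k (v, InCorner) <> k (v, OutCorner).

Definition smooth_state (M : set marker) : set marker := M `\` [set m | m.1 = v].

Definition merged_states : set (set marker) :=
  marker_states C S k `&` [set M | exists2 c, merged_corner c & M (v, c)].

Lemma phi_mergedE r : merged_region r -> phi r = phi (k (v, OutCorner)).
Proof. by move=> [c + ->]; case: c. Qed.

Lemma merged_opposite c c' : merged_corner c -> merged_corner c' ->
  c' <> c -> c' = opposite c.
Proof. by case: c; case: c'. Qed.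

Lemma S0_opposite c : merged_corner c ->
  S0 (phi (k (v, OutCorner))) <-> S (k (v, c)) /\ S (k (v, opposite c)).
Proof. by case: c => // _; rewrite S0_merged//; tauto. Qed.

Lemma merged_regionP c r : merged_corner c -> merged_region r -> r <> k (v, c) ->
  r = k (v, opposite c).
Proof.
move=> mc [c' mc' ->] ne; congr (k (v, _)); apply: merged_opposite => //.
by move=> cc; apply: ne; rewrite cc.
Qed.

Lemma opposite_distinct c : merged_corner c -> k (v, opposite c) <> k (v, c).
Proof. by case: c => // _ /= e; apply: k_distinct. Qed.

Lemma merged_opposite_region c : merged_corner c -> merged_region (k (v, opposite c)).
Proof. by move=> mc; exists (opposite c) => //; case: c mc. Qed.

Lemma smooth_state_states M :
  merged_states M -> marker_states (C `\ v) S0 k0 (smooth_state M).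
Proof.
move=> [MS [c mc Mc]]; have [MC MR MT] := MS; have [_ Sc] := MC _ Mc.
have rinj := state_region_inj _ _ _ _ MS; have cinj := state_crossing_inj _ _ _ _ MS.
have mreg m : M m -> m.1 <> v -> merged_region (k m) -> k m = k (v, opposite c).
  move=> Mm mv mm; apply: merged_regionP => // e; apply: mv.
  by rewrite (rinj _ _ Mm Mc e).
have phieq m r : M m -> m.1 <> v -> S r -> r <> k (v, c) -> phi (k m) = phi r -> k m = r.
  move=> Mm mv Sr rc e; have [_ Sm] := MC _ Mm.
  have [//|[mm mr]] := phi_eq _ _ Sm Sr e.
  by rewrite (mreg m)// (merged_regionP c r).
split=> [m [Mm mv]|F S0F|p [Cp pv]].
- have [Cm Sm] := MC _ Mm; split; first by split.
  rewrite k0E//; have [mm|mm] := pselect (merged_region (k m)); last exact: phi_unmerged.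
  rewrite phi_mergedE//; apply/(S0_opposite c mc); split => //.
  by rewrite -(mreg m).
- have [r [Sr rc <-]] : exists r, [/\ S r, r <> k (v, c) & phi r = F].
    have [r Sr rF] := phi_surj _ S0F.
    have [rc|rc] := pselect (r = k (v, c)); last by exists r.
    exists (k (v, opposite c)).
    have pr : phi r = phi (k (v, OutCorner)) by apply: phi_mergedE; rewrite rc; exists c.
    split.
    + by have [|//] := proj1 (S0_opposite c mc); rewrite -pr rF.
    + exact: opposite_distinct.
    + by rewrite phi_mergedE -?pr//; exact: merged_opposite_region.
  have [m [[Mm mr] u]] := MR _ Sr.
  have mv : m.1 <> v by move=> mv; apply: rc; rewrite -mr (cinj m (v, c)).
  exists m; split; first by split; [split|rewrite k0E ?mr//; have [] := MC _ Mm].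
  move=> m' [[Mm' mv']]; rewrite k0E//; last by have [] := MC _ Mm'.
  by move=> e; apply: u; split=> //; exact: phieq.
- have [m [[Mm mp] u]] := MT _ Cp; exists m; split.
    by split=> //; split=> //= mv; apply: pv; rewrite -mp.
  by move=> m' [[Mm' _] mp']; exact: u.
Qed.

Lemma smooth_stateK M c : marker_states C S k M -> M (v, c) ->
  M = (v, c) |` smooth_state M.
Proof.
move=> MS Mc; apply/seteqP; split=> [m Mm|m [->//|[]//]].
have [mv|mv] := pselect (m.1 = v); last by right.
by left; exact: (state_crossing_inj _ _ _ _ MS).
Qed.

Lemma smooth_state_inj M M' : merged_states M -> merged_states M' ->
  smooth_state M = smooth_state M' -> M = M'.
Proof.
move=> [MS [c mc Mc]] [MS' [c' mc' Mc']] e.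
rewrite (smooth_stateK _ _ MS Mc) (smooth_stateK _ _ MS' Mc') e.
have [->//|cc] := pselect (c = c').
have [MC' _ _] := MS'; have [_ MR _] := MS; have [_ Sc'] := MC' _ Mc'.
have [m [[Mm mr] _]] := MR _ Sc'.
have [mv|mv] := pselect (m.1 = v).
  have mE := state_crossing_inj _ _ _ _ MS _ _ Mm Mc mv.
  have [] := opposite_distinct c mc; rewrite -(merged_opposite c c')//; last exact: nesym.
  by rewrite -mr mE.
have : smooth_state M m by split.
rewrite e => -[Mm' _]; case: mv.
by rewrite (state_region_inj _ _ _ _ MS' _ _ Mm' Mc' mr).
Qed.

Lemma smooth_state_surj M0 : marker_states (C `\ v) S0 k0 M0 ->
  exists2 M, merged_states M & smooth_state M = M0.
Proof.
move=> MS0; have [MC MR MT] := MS0.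
have mk m : M0 m -> [/\ C m.1, m.1 <> v, k0 m = phi (k m) & S (k m)].
  move=> Mm; have [[Cm mv] Sm] := MC _ Mm; split=> //; first exact: k0E.
  by apply: phi_S => //; rewrite -k0E.
have rinj := state_region_inj _ _ _ _ MS0.
have [c [mc Sc Mc Moc]] : exists c, [/\ merged_corner c, S (k (v, c)),
    forall m, M0 m -> k m <> k (v, c) &
    S (k (v, opposite c)) -> exists m, M0 m /\ k m = k (v, opposite c)].
  have [S0F|S0F] := pselect (S0 (phi (k (v, OutCorner)))).
    have [m [[Mm mF] _]] := MR _ S0F; have [Cm mv k0m Sm] := mk _ Mm.
    have mm : merged_region (k m).
      have : phi (k m) = phi (k (v, OutCorner)) by rewrite -k0m.
      move/phi_eq => -[//||->|[]//]; first by have [] := proj1 S0_merged S0F.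
      by exists OutCorner.
    have [c' mc' mc'E] := mm; exists (opposite c').
    have mo : merged_corner (opposite c') by case: c' mc' {mc'E}.
    have oo : opposite (opposite c') = c' by case: c' {mo mc' mc'E}.
    have [Sc' So] := proj1 (S0_opposite c' mc') S0F.
    split=> //.
      move=> m' Mm' e; have [_ _ k0m' Sm'] := mk _ Mm'.
      have mm' : m' = m.
        apply: rinj => //; rewrite k0m k0m' e mc'E.
        by rewrite !phi_mergedE//; [exists c'|exists (opposite c')].
      by apply: (opposite_distinct c' mc'); rewrite -e mm'.
    by rewrite oo => _; exists m.
  have [c mc Sc] : exists2 c, merged_corner c & S (k (v, c)).
    by case: S_merged; [exists InCorner|exists OutCorner].
  exists c; split=> // [m Mm e|So].
    have [_ _ k0m _] := mk _ Mm; have [_] := MC _ Mm.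
    by rewrite k0m e phi_mergedE//; exists c.
  by exfalso; apply: S0F; apply/(S0_opposite c mc).
have Mv m : M0 m -> m.1 <> v by move=> /mk[].
exists ((v, c) |` M0); last first.
  apply/seteqP; split=> [m [[->|//] /(_ erefl)]//|m Mm].
  by split; [right|exact: Mv].
split; last by exists c => //; left.
split=> [m [->//|/mk[]//]|r Sr|p Cp].
- have [->|rc] := pselect (r = k (v, c)).
    exists (v, c); split; first by split=> //; left.
    by move=> m [[->//|/Mc//]].
  have [m [Mm mr]] : exists m, M0 m /\ k m = r.
    have [mr|mr] := pselect (merged_region r).
      by move: Sr; rewrite (merged_regionP c r)//.
    have [m [[Mm mr'] _]] := MR _ (phi_unmerged _ Sr mr); exists m; split => //.
    have [_ _ k0m Sm] := mk _ Mm; rewrite k0m in mr'.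
    by have [//|[_ /mr]] := phi_eq _ _ Sm Sr mr'.
  exists m; split; first by split=> //; right.
  move=> m' [[->|Mm'] m'r]; first by case: rc.
  apply: rinj => //; have [_ _ -> _] := mk _ Mm; have [_ _ -> _] := mk _ Mm'.
  by rewrite mr m'r.
- have [->|pv] := pselect (p = v).
    exists (v, c); split; first by split=> //; left.
    by move=> m [[->//|/Mv//]].
  have [m [[Mm mp] u]] := MT p (conj Cp pv); exists m; split; first by split=> //; right.
  by move=> m' [[->|Mm'] mp'] ; [case: pv|exact: u].
Qed.

Lemma smooth_state_bij :
  set_bij merged_states (marker_states (C `\ v) S0 k0) smooth_state.
Proof.
split.
- exact: smooth_state_states.
- by move=> M M'; rewrite !inE; exact: smooth_state_inj.
- by move=> M0 /smooth_state_surj[M MS <-]; exists M.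
Qed.

Section Weights.
Context {A : idomainType} (lp lm l0 : marker -> A) (w : A).
Hypothesis C_finite : finite_set C.
Hypothesis lpE : forall m, C m.1 -> m.1 <> v -> lp m = l0 m.
Hypothesis lmE : forall m, C m.1 -> m.1 <> v -> lm m = l0 m.
Hypothesis l_merged : forall c, merged_corner c -> lp (v, c) - lm (v, c) = w.
Hypothesis l_side : forall c, ~~ merged_corner c -> lp (v, c) = lm (v, c).

Lemma state_weight (l : marker -> A) M c :
  (forall m, C m.1 -> m.1 <> v -> l m = l0 m) ->
  marker_states C S k M -> M (v, c) ->
  \big[*%R/1]_(m \in M) l m = l (v, c) * \big[*%R/1]_(m \in smooth_state M) l0 m.
Proof.
move=> lE MS Mc; rewrite (fsbigD1 (v, c))//; last exact: state_finite MS.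
have -> : M `\ (v, c) = smooth_state M.
  apply/seteqP; split=> m [Mm mc]; split=> // mv; apply: mc.
    exact: (state_crossing_inj _ _ _ _ MS).
  by rewrite /= mv.
congr (_ * _); apply: eq_fsbigr => m; rewrite inE => -[Mm mv].
by apply: lE => //; have [MC _ _] := MS; have [] := MC _ Mm.
Qed.

Lemma weight_diff M : marker_states C S k M ->
  \big[*%R/1]_(m \in M) lp m - \big[*%R/1]_(m \in M) lm m =
  if M \in [set M | exists2 c, merged_corner c & M (v, c)]
  then w * \big[*%R/1]_(m \in smooth_state M) l0 m else 0.
Proof.
move=> MS; have [MC _ MT] := MS; have [[v' c] [[Mc /= v'v] _]] := MT _ Cv.
rewrite {}v'v in Mc; rewrite (state_weight _ _ _ lpE MS Mc).
rewrite (state_weight _ _ _ lmE MS Mc) -mulrBl.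
have [mc|sc] := boolP (merged_corner c).
  by rewrite l_merged// ifT// inE; exists c.
rewrite l_side// subrr mul0r ifF//; apply/negbTE/negP; rewrite inE => -[c' mc' Mc'].
have [cc] := state_crossing_inj _ _ _ _ MS _ _ Mc Mc' erefl.
by move: sc; rewrite cc mc'.
Qed.

Lemma marker_skein :
  \sum_(M \in marker_states C S k) \big[*%R/1]_(m \in M) lp m
  - \sum_(M \in marker_states C S k) \big[*%R/1]_(m \in M) lm m =
  w * \sum_(M \in marker_states (C `\ v) S0 k0) \big[*%R/1]_(m \in M) l0 m.
Proof.
have fS := marker_states_finite C S k C_finite.
rewrite (reindex_fsbig smooth_state _ _ _ smooth_state_bij).
rewrite mulr_fsumr fsbig_mkcondr.
apply/eqP; rewrite subr_eq addrC -fsbig_split//; apply/eqP.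
apply: eq_fsbigr => M; rewrite inE => MS.
by rewrite /= -weight_diff// addrCA subrr addr0.
Qed.

End Weights.

End Smoothing.

(** * Skein triples *)

Lemma corner_regionE {R : realType} (D : diagram R) p c :
  corner_region D p c = germ_region (sphere `\` universe D) (corner_point D p c).
Proof. by []. Qed.

Lemma corner_continuous {R : realType} (D : diagram R) p c : sphere p ->
  \forall t \near 0^'+, {for t, continuous (corner_point D p c)}.
Proof. by move=> p1; apply: filterS (corner_point_right D p c p1) => t []. Qed.

Lemma corner_region_region {R : realType} (D : diagram R) p c : crossings D p ->
  corner_region D p c !=set0 -> regions D (corner_region D p c).
Proof.
move=> /crossing_sphere p1; rewrite corner_regionE.
exact/germ_region_region/corner_continuous.
Qed.

Section SkeinDiagrams.
Context {R : realType} {Lp L0 : starred_diagram R} {v : 'rV[R]_3}.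
Context {h : R * R -> 'rV[R]_3} {g : R -> R}.
Hypothesis smoothing : oriented_smoothing Lp L0 v h g.
Hypothesis stars : smoothing_stars Lp L0 v h.

Let B := h @` box.
Let X := sphere `\` universe Lp.
Let X0 := sphere `\` universe L0.
Let phi := smoothed (universe L0) h.

Let v_range : range h v.
Proof. by have [_ _ _ [[_ <- _ _ _] _ _ _]] := smoothing; exists (0, 0). Qed.

Let crossing_range p : crossings Lp p -> p <> v -> ~ range h p.
Proof.
have [_ _ _ [[_ _ _ crU _] _ _ _ _]] := smoothing => cp pv hp.
by have : [set v] p by rewrite -crU.
Qed.

Let range_box p : ~ range h p -> ~ B p.
Proof. by move=> hp [w _ wp]; apply: hp; exists w. Qed.

Let oriented p : ~ B p ->
  forall u, oriented_universe Lp p u <-> oriented_universe L0 p u.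
Proof. by have [_ _ _ [_ _ _ OU _]] := smoothing => nB u; exact: OU. Qed.

Lemma skein_local_smoothing : local_smoothing (universe Lp) (universe L0) h g.
Proof.
have [cg g0 gout [[emb _ hU _ _] hU0 _ _ _]] := smoothing.
split=> // [|p nB]; first by split; exact: universe_closed.
by split=> /universeP[u pu]; apply/universeP; exists u; exact/(oriented _ nB).
Qed.

Let sm := skein_local_smoothing.

Lemma smoothing_crossings : crossings L0 = crossings Lp `\ v.
Proof.
have [_ _ _ [_ _ cr0 _ _]] := smoothing.
apply/seteqP; split=> [p cp|p [cp pv]].
  have hp : ~ range h p by move=> hp; have : set0 p by rewrite -cr0.
  split; last by move=> pv; apply: hp; rewrite pv.
  by apply: crossings_oriented cp => u; symmetry; apply/oriented/range_box.
by apply: crossings_oriented (cp); apply/oriented/range_box/crossing_range.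
Qed.

Lemma smoothing_corner_point p : crossings Lp p -> p <> v ->
  corner_point Lp p = corner_point L0 p /\
  `[< positive_crossing Lp p >] = `[< positive_crossing L0 p >].
Proof.
have [_ _ _ [_ _ _ _ ov]] := smoothing => cp pv.
apply: (corner_point_eq _ _ _ _ cp (ov _ cp pv)).
exact/oriented/range_box/crossing_range.
Qed.

Lemma smoothing_corner_region p c : crossings Lp p -> p <> v ->
  corner_region L0 p c = phi (corner_region Lp p c).
Proof.
move=> cp pv; rewrite !corner_regionE.
rewrite -(proj1 (smoothing_corner_point _ cp pv)).
have p1 := crossing_sphere _ _ cp.
apply: (smoothed_germ sm); first exact: corner_continuous.
apply: corner_point_near => //; first exact: (closed_chart_box sm).
exact/range_box/crossing_range.
Qed.

Lemma center_corner_region c :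
  corner_region Lp v c = connected_component X (h (corner_sample c)).
Proof.
have [_ _ _ [[_ _ _ crU cc] _ _ _ _]] := smoothing.
have cv : crossings Lp v by have : [set v] v by []; rewrite -crU => -[].
apply: (quadrant_germ sm).
  exact: (corner_continuous _ _ _ (crossing_sphere _ _ cv)).
exact: cc.
Qed.

Hypothesis distinct : corner_region Lp v InCorner <> corner_region Lp v OutCorner.

Let k (m : 'rV[R]_3 * corner) := corner_region Lp m.1 m.2.

Let center_crossing : crossings Lp v.
Proof.
have [_ _ _ [[_ _ _ crU _] _ _ _ _]] := smoothing.
by have : [set v] v by []; rewrite -crU => -[].
Qed.

Let center_region c : regions Lp (k (v, c)).
Proof.
rewrite /k center_corner_region.
exists (h (corner_sample c)) => //.
exact: (quadrant_off_universe sm _ _ (corner_sample_quadrant c)).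
Qed.

Lemma smoothed_starred F : starred_regions L0 F <->
  exists2 r, starred_regions Lp r & phi r = F.
Proof.
rewrite (proj1 stars); split=> [[F0 [r rs /(smoothed_meet sm) rF]]|[r rs <-]].
  by exists r => //; rewrite rF//; exact: starred_regionsP rs.
have rr := starred_regionsP rs; have pr := smoothed_region sm _ rr.
by split=> //; exists r => //; apply/(smoothed_meet sm).
Qed.

Lemma unstarred_smoothed r : unstarred_regions L0 (phi r) ->
  ~ starred_regions Lp r.
Proof. by move=> [_ n] rs; apply: n; apply/smoothed_starred; exists r. Qed.

Lemma unstarred_smoothed_surj F : unstarred_regions L0 F ->
  exists2 r, unstarred_regions Lp r & phi r = F.
Proof.
move=> F0; have [r rr rF] := smoothed_surj sm _ (proj1 F0); exists r => //.
by split=> //; apply: unstarred_smoothed; rewrite [phi r]rF.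
Qed.

Lemma regions_smoothed_eq r r' : regions Lp r -> regions Lp r' -> phi r = phi r' ->
  r = r' \/ merged_region v k r /\ merged_region v k r'.
Proof.
move=> rr rr' /(smoothed_eq sm _ _ rr rr').
rewrite -!center_corner_region => -[->|[a b]]; [by left|right].
by split; [case: a => ->|case: b => ->]; by [exists InCorner|exists OutCorner].
Qed.

Lemma unmerged_smoothed r : unstarred_regions Lp r -> ~ merged_region v k r ->
  unstarred_regions L0 (phi r).
Proof.
move=> [rr rs] mr; split; first exact: (smoothed_region sm).
move=> /smoothed_starred[r' r's e].
have [e'|[//]] := regions_smoothed_eq _ _ (starred_regionsP r's) rr e.
by apply: rs; rewrite -e'.
Qed.

Lemma smoothed_center : phi (k (v, InCorner)) = phi (k (v, OutCorner)).
Proof. by rewrite /k !center_corner_region; exact: (smoothed_merge sm). Qed.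

Lemma unstarred_center : unstarred_regions L0 (phi (k (v, OutCorner))) <->
  unstarred_regions Lp (k (v, InCorner)) /\ unstarred_regions Lp (k (v, OutCorner)).
Proof.
split=> [u|[[_ nI] [_ nO]]].
  split; split; try exact: center_region; apply: unstarred_smoothed => //.
  by rewrite smoothed_center.
split; first exact: (smoothed_region sm _ (center_region _)).
move=> /smoothed_starred[r rs e].
have [re|[[c mc re] _]] :=
  regions_smoothed_eq _ _ (starred_regionsP rs) (center_region _) e.
  by rewrite re in rs.
by rewrite re in rs; case: c mc {re} rs.
Qed.

Lemma smoothing_unstarred_crossings :
  unstarred_crossings L0 = unstarred_crossings Lp `\ v.
Proof.
rewrite /unstarred_crossings smoothing_crossings (proj2 stars).
apply/seteqP; split=> p [[cp pv] ps]; split=> //; first by split=> // ?; apply: ps.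
by move=> [].
Qed.

Lemma unstarred_crossings_finite : finite_set (unstarred_crossings Lp).
Proof.
apply: finite_setD; have [_ _ _ _ [_ _]] := diagram_immersion Lp; exact.
Qed.

(* If [v] were starred, no region would be, and [L0] would have as many unstarred
   crossings as [Lp] but one region fewer. *)
Lemma center_unstarred : unstarred_crossings Lp v.
Proof.
split=> // sv.
have sR : starred_regions Lp = set0.
  by case: (starred_kind Lp) => // e; rewrite e in sv.
have Cv : unstarred_crossings L0 = unstarred_crossings Lp.
  by rewrite smoothing_unstarred_crossings not_setD1// => -[].
have fS : finite_set (unstarred_regions Lp).
  have /card_eqPle[le _] := starred_balance Lp.
  exact: card_le_finite le unstarred_crossings_finite.
apply: (finite_card_setD1 _ (k (v, InCorner)) fS).
  by split; [exact: center_region|rewrite sR].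
apply: (@card_le_trans _ _ _ (unstarred_regions L0)).
  apply: (@card_le_trans _ _ _ (unstarred_crossings L0)).
    by rewrite Cv; have /card_eqPle[] := starred_balance Lp.
  by have /card_eqPle[] := starred_balance L0.
apply: card_le_trans (card_image_le phi _); apply: subset_card_le.
move=> F /unstarred_smoothed_surj[r Sr <-].
have [->|rI] := pselect (r = k (v, InCorner)); last by exists r.
exists (k (v, OutCorner)); last by rewrite smoothed_center.
split; last exact: nesym.
by split; [exact: center_region|rewrite sR].
Qed.

(* If both merged regions were starred, the smoothing would remove an unstarred
   crossing but no unstarred region. *)
Lemma center_region_unstarred : unstarred_regions Lp (k (v, InCorner)) \/
  unstarred_regions Lp (k (v, OutCorner)).
Proof.
apply: contrapT => /not_orP[nI nO].
have mS r : unstarred_regions Lp r -> ~ merged_region v k r.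
  by move=> Sr [c mc re]; rewrite re in Sr; case: c mc Sr {re}.
apply: (finite_card_setD1 _ v unstarred_crossings_finite center_unstarred).
rewrite -smoothing_unstarred_crossings.
apply: (@card_le_trans _ _ _ (unstarred_regions L0)); last first.
  by have /card_eqPle[] := starred_balance L0.
apply: (@card_le_trans _ _ _ (unstarred_regions Lp)).
  by have /card_eqPle[] := starred_balance Lp.
have inj : {in unstarred_regions Lp &, injective phi}.
  move=> r r'; rewrite !inE => Sr Sr' /regions_smoothed_eq.
  by move=> /(_ (proj1 Sr) (proj1 Sr'))[//|[/(mS _ Sr)]].
have /card_eqPle[_ le] := inj_card_eq inj; apply: (card_le_trans le).
by apply: subset_card_le => _ [r Sr <-]; exact: unmerged_smoothed (mS _ Sr).
Qed.

Lemma unstarred_of_smoothed p c : crossings Lp p ->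
  unstarred_regions L0 (phi (corner_region Lp p c)) ->
  unstarred_regions Lp (corner_region Lp p c).
Proof.
move=> cp u; split; last exact: unstarred_smoothed.
apply: corner_region_region => //.
have [[x X0x xE] _] := u; apply: (@smoothed_neq0 _ (universe L0) h).
by rewrite -/phi -xE; exists x; exact: connected_component_refl.
Qed.

Lemma state_sum_skein (A : idomainType)
    (lp lm l0 : 'rV[R]_3 * corner -> A) (w : A) :
  (forall m, unstarred_crossings Lp m.1 -> m.1 <> v -> lp m = l0 m) ->
  (forall m, unstarred_crossings Lp m.1 -> m.1 <> v -> lm m = l0 m) ->
  (forall c, merged_corner c -> lp (v, c) - lm (v, c) = w) ->
  (forall c, ~~ merged_corner c -> lp (v, c) = lm (v, c)) ->
  \sum_(M \in states Lp) \big[*%R/1]_(m \in M) lp m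
  - \sum_(M \in states Lp) \big[*%R/1]_(m \in M) lm m =
  w * \sum_(M \in states L0) \big[*%R/1]_(m \in M) l0 m.
Proof.
move=> lpE lmE lmer lside.
have -> : states L0 = marker_states (unstarred_crossings Lp `\ v)
    (unstarred_regions L0) (fun m => corner_region L0 m.1 m.2).
  by rewrite -smoothing_unstarred_crossings.
apply: (@marker_skein _ _ _ _ v (unstarred_regions Lp) _ k _ phi) => //.
- exact: center_unstarred.
- by move=> m [cm _] mv; exact: smoothing_corner_region.
- exact: unstarred_smoothed_surj.
- by move=> r r' [rr _] [rr' _]; exact: regions_smoothed_eq.
- exact: smoothed_center.
- exact: unmerged_smoothed.
- by move=> m [cm _] _; exact: unstarred_of_smoothed.
- exact: unstarred_center.
- exact: center_region_unstarred.
- exact: unstarred_crossings_finite.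
Qed.

End SkeinDiagrams.

Section CrossingChange.
Context {R : realType} {Lp Lm : starred_diagram R} {v : 'rV[R]_3}.
Hypothesis change : crossing_change Lp Lm v.

Let OU p u : oriented_universe Lp p u <-> oriented_universe Lm p u.
Proof. by have [_ OU _ _ _] := change; exact: OU. Qed.

Lemma change_universe : universe Lp = universe Lm.
Proof. exact: universe_eq. Qed.

Lemma change_unstarred_regions : unstarred_regions Lm = unstarred_regions Lp.
Proof.
have [_ _ _ sR _] := change.
by rewrite /unstarred_regions /regions sR change_universe.
Qed.

Lemma change_unstarred_crossings : unstarred_crossings Lm = unstarred_crossings Lp.
Proof.
have [_ _ _ _ sC] := change; rewrite /unstarred_crossings sC.
congr (_ `\` _); apply/seteqP; split=> p.
  by apply: crossings_oriented => u; symmetry.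
exact: crossings_oriented.
Qed.

Lemma change_corner_region p : crossings Lp p ->
  corner_region Lm p = corner_region Lp p.
Proof.
have [[pos neg] _ over _ _] := change => cp.
apply: corner_region_eq; first exact: esym change_universe.
have [->|pv] := pselect (p = v).
  exact: esym (corner_point_change _ _ _ (OU v) pos neg).
exact: esym (proj1 (corner_point_eq _ _ _ (OU p) cp (over _ cp pv))).
Qed.

Lemma change_states : states Lm = states Lp.
Proof.
have <- : marker_states (unstarred_crossings Lp) (unstarred_regions Lp)
    (fun m => corner_region Lm m.1 m.2) = states Lm.
  by rewrite -change_unstarred_regions -change_unstarred_crossings.
apply: marker_states_ext => m [cm _].
by rewrite change_corner_region.
Qed.

End CrossingChange.

Lemma label_eq {R : realType} (L L' : starred_diagram R) m :
  `[< positive_crossing L m.1 >] = `[< positive_crossing L' m.1 >] ->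
  label L m = label L' m.
Proof. by rewrite /label => ->; reflexivity. Qed.

Theorem theorem4 (R : realType) (Lp Lm L0 : starred_diagram R) (v : 'rV[R]_3)
    (hskein : skein_triple Lp Lm L0 v)
    (hdistinct_p : injective (corner_region Lp v))
    (hdistinct_m : injective (corner_region Lm v))
    (hstars :
      [\/ forall c, ~ starred_regions Lp (corner_region Lp v c),
          exists c c', [/\ adjacent_corners c c',
            starred_regions Lp (corner_region Lp v c) &
            starred_regions Lp (corner_region Lp v c')] |
          starred_regions Lp (corner_region Lp v UpCorner) /\
          starred_regions Lp (corner_region Lp v DownCorner)]) :
  mock_alexander Lp - mock_alexander Lm = (W - W^-1) * mock_alexander L0.
Proof.
have [change [h [g [smoothing stars]]]] := hskein.
have [[pos neg] OU over _ _] := change.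
have distinct : corner_region Lp v InCorner <> corner_region Lp v OutCorner.
  by move=> /hdistinct_p.
rewrite /mock_alexander (change_states change).
apply: (state_sum_skein smoothing stars distinct).
- move=> m [cm _] mv; apply: label_eq.
  exact: (proj2 (smoothing_corner_point smoothing _ cm mv)).
- move=> m [cm _] mv; apply: label_eq.
  rewrite -(proj2 (smoothing_corner_point smoothing _ cm mv)).
  exact: esym (proj2 (corner_point_eq _ _ _ (OU _) cm (over _ cm mv))).
- move=> c; rewrite /label /= (asboolT pos) (asboolF (negative_not_positive _ _ neg)).
  by case: c => //= _; rewrite opprK addrC.
- by case=> /= sc; [discriminate sc|discriminate sc|reflexivity|reflexivity].
Qed.
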